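(* Let $\mathcal{M}$ be an embedded Riemannian submanifold of $\mathbb{R}^n$ with $\dim(\mathcal{M})=d$ and let $1\le k<d$. Suppose that: (i) $\mathrm{R}^{\mathcal{M}}:\mathrm{T}\mathcal{M}\to\mathcal{M}$ is a retraction on $\mathcal{M}$; (ii) for any $(\mathbf{x},P)\in\mathrm{Gr}_k(\mathrm{T}\mathcal{M})$ with $V\in\mathrm{St}_k(\mathrm{T}_{\mathbf{x}}\mathcal{M})$ such that $P=VV^\top$, the map $\widehat{\mathrm{R}}_{P,V}:\mathrm{T}_P\big(\mathrm{Gr}_k(\mathrm{T}_{\mathbf{x}}\mathcal{M})\big)\to\mathbb{R}^{n\times k}$ is smooth and fulfills $$\widehat{\mathrm{R}}_{P,V}(0)=V,$$ $$\mathrm{Ran}\big(\widehat{\mathrm{R}}_{P,V}(\Delta)\big)\subseteq\mathrm{T}_{\mathbf{x}}\mathcal{M},\qquad\mathrm{rank}\big(\widehat{\mathrm{R}}_{P,V}(\Delta)\big)=k,$$ $$\widehat{\mathrm{R}}_{P,VQ}(\Delta)=\widehat{\mathrm{R}}_{P,V}(\Delta)Q\quad\forall\,Q\in\mathcal{O}(k),$$ $$\mathrm{D}\widehat{\mathrm{R}}_{P,V}(0)[\Delta]V^\top+V\,\mathrm{D}\widehat{\mathrm{R}}_{P,V}(0)[\Delta]^\top=\Delta,$$ for any $\Delta\in\mathrm{T}_P(\mathrm{Gr}_k(\mathrm{T}_{\mathbf{x}}\mathcal{M}))$ sufficiently small; (iii) $\mathrm{VT}^{\mathcal{M}}$ is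 a vector transport associated with $\mathrm{R}^{\mathcal{M}}$ on $\mathcal{M}$ such that, for any $(\mathbf{x},\boldsymbol\delta)\in\mathrm{T}\mathcal{M}$, $$\mathrm{D}\big(\iota\mapsto\mathrm{VT}^{\mathcal{M}}_{(\mathbf{x},\iota)}\big)(0)[\boldsymbol\delta](\mathbf{v})=\mathrm{II}_{\mathbf{x}}(\boldsymbol\delta,\mathbf{v})\in\mathrm{N}_{\mathbf{x}}\mathcal{M}$$ holds for any $\mathbf{v}\in\mathrm{T}_{\mathbf{x}}\mathcal{M}$, and, for any $\mathbf{x}\in\mathcal{M}$, there exists a neighborhood $\mathcal{N}_1$ of the origin in $\mathrm{T}_{\mathbf{x}}\mathcal{M}$ such that $\mathrm{VT}^{\mathcal{M}}_{(\mathbf{x},\boldsymbol\delta)}:\mathrm{T}_{\mathbf{x}}\mathcal{M}\to\mathrm{T}_{\mathrm{R}^{\mathcal{M}}_{\mathbf{x}}(\boldsymbol\delta)}\mathcal{M}$ is injective for any $\boldsymbol\delta\in\mathcal{N}_1$. Then $\mathrm{R}^{\mathrm{Gr}_k(\mathrm{T}\mathcal{M})}:\mathrm{T}(\mathrm{Gr}_k(\mathrm{T}\mathcal{M}))\to\mathrm{Gr}_k(\mathrm{T}\mathcal{M})$ defined as $$\mathrm{R}^{\mathrm{Gr}_k(\mathrm{T}\mathcal{M})}_{(\mathbf{x},P)}(\boldsymbol\delta,\Delta):=\big(\mathrm{R}^{\mathcal{M}}_{\mathbf{x}}(\boldsymbol\delta),\ \tilde P_{\mathbf{x},P}(\boldsymbol\delta,\Delta)\big)$$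 for any $\big((\mathbf{x},P),(\boldsymbol\delta,\Delta)\big)\in\mathrm{T}(\mathrm{Gr}_k(\mathrm{T}\mathcal{M}))$, with (for $V\in\mathrm{St}_k(\mathrm{T}_{\mathbf{x}}\mathcal{M})$ such that $P=VV^\top$) $$\tilde P_{\mathbf{x},P}(\boldsymbol\delta,\Delta):=\tilde V_{\mathbf{x},P,V}(\boldsymbol\delta,\Delta)\,\tilde V_{\mathbf{x},P,V}(\boldsymbol\delta,\Delta)^\top,$$ $$\tilde V_{\mathbf{x},P,V}(\boldsymbol\delta,\Delta):=Y_{\mathbf{x},P,V}(\boldsymbol\delta,\Delta)\big(Y_{\mathbf{x},P,V}(\boldsymbol\delta,\Delta)^\top Y_{\mathbf{x},P,V}(\boldsymbol\delta,\Delta)\big)^{-1/2},$$ $$Y_{\mathbf{x},P,V}(\boldsymbol\delta,\Delta):=\mathrm{VT}^{\mathcal{M}}_{(\mathbf{x},\boldsymbol\delta)}\big(Z_{\mathbf{x},P,V}(\Delta)\big)\ \text{(acting columnwise)},\qquad Z_{\mathbf{x},P,V}(\Delta):=\widehat{\mathrm{R}}_{P,V}(\Delta_{\mathbf{x}}),$$ where $\Delta_{\mathbf{x}}:=\mathrm{Proj}_{\mathrm{T}_{\mathbf{x}}\mathcal{M}}\circ\Delta\circ\mathrm{Proj}_{\mathrm{T}_{\mathbf{x}}\mathcal{M}}$, is a retraction on $\mathrm{Gr}_k(\mathrm{T}\mathcal{M})$. Its representative on $\mathrm{St}_k(\mathrm{T}\mathcal{M})$ is $$\mathrm{R}^{\mathrm{Gr}_k(\mathrm{T}\mathcal{M})}_{(\mathbf{x},V)}(\boldsymbol\delta,\Delta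 V):=\big(\mathrm{R}^{\mathcal{M}}_{\mathbf{x}}(\boldsymbol\delta),\tilde V_{\mathbf{x},P,V}(\boldsymbol\delta,\Delta)\big).$$
   Context: $\mathcal{M}$ carries the metric induced from $\mathbb{R}^n$; $\mathrm{Proj}_{\mathrm{T}_{\mathbf{x}}\mathcal{M}}$ is the orthogonal projector of $\mathbb{R}^n$ onto $\mathrm{T}_{\mathbf{x}}\mathcal{M}$, and $\mathrm{N}_{\mathbf{x}}\mathcal{M}$ is the normal space (orthogonal complement of $\mathrm{T}_{\mathbf{x}}\mathcal{M}$). $\mathrm{St}_k(\mathrm{T}_{\mathbf{x}}\mathcal{M})$ is the set of $n\times k$ matrices with orthonormal columns in $\mathrm{T}_{\mathbf{x}}\mathcal{M}$; $\mathrm{Gr}_k(\mathrm{T}_{\mathbf{x}}\mathcal{M})$ is the Grassmann manifold of $k$-dimensional subspaces of $\mathrm{T}_{\mathbf{x}}\mathcal{M}$, identified with orthogonal projectors $P\in\mathbb{R}^{n\times n}_{\mathrm{sym}}$ onto them. $\mathrm{St}_k(\mathrm{T}\mathcal{M}):=\{(\mathbf{x},V)\mid\mathbf{x}\in\mathcal{M},V\in\mathrm{St}_k(\mathrm{T}_{\mathbf{x}}\mathcal{M})\}$ and $\mathrm{Gr}_k(\mathrm{T}\mathcal{M}):=\{(\mathbf{x},P)\mid\mathbf{x}\in\mathcal{M},P\in\mathrm{Gr}_k(\mathrm{T}_{\mathbf{x}}\mathcal{M})\}$ are embedded submanifolds of $\mathbb{R}^n\times\mathbb{R}^{n\times k}$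 and $\mathbb{R}^n\times\mathbb{R}^{n\times n}_{\mathrm{sym}}$. $\mathcal{O}(k)$ is the orthogonal group of degree $k$. $\mathrm{II}_{\mathbf{x}}(\mathbf{u},\mathbf{v}):=\mathrm{D}(\mathbf{y}\mapsto\mathrm{Proj}_{\mathrm{T}_{\mathbf{y}}\mathcal{M}})(\mathbf{x})[\mathbf{u}](\mathbf{v})$ is the second fundamental form. For $(\mathbf{x},V)\in\mathrm{St}_k(\mathrm{T}\mathcal{M})$ with $P=VV^\top$, the horizontal lift of $(\boldsymbol\delta,\Delta)\in\mathrm{T}_{(\mathbf{x},P)}\mathrm{Gr}_k(\mathrm{T}\mathcal{M})$ is $(\boldsymbol\delta,\Delta V)$; ''representative'' means that applying $(\mathbf{x},V)\mapsto(\mathbf{x},VV^\top)$ gives the retraction on $\mathrm{Gr}_k(\mathrm{T}\mathcal{M})$. A retraction on a manifold $\mathcal{N}$ is a smooth map $\mathrm{R}:\mathrm{T}\mathcal{N}\to\mathcal{N}$, $(\mathbf{y},\mathbf{u})\mapsto\mathrm{R}_{\mathbf{y}}(\mathbf{u})$, with $\mathrm{R}_{\mathbf{y}}(0)=\mathbf{y}$ and $\mathrm{D}\mathrm{R}_{\mathbf{y}}(0)=\mathrm{Id}_{\mathrm{T}_{\mathbf{y}}\mathcal{N}}$ for all $\mathbf{y}\in\mathcal{N}$. A vector transport associated with $\mathrm{R}^{\mathcal{M}}$ is a smooth map assigning to $\mathbf{x}\in\mathcal{M}$, $\mathbf{u},\mathbf{v}\in\mathrm{T}_{\mathbf{x}}\mathcal{M}$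 a vector $\mathrm{VT}^{\mathcal{M}}_{(\mathbf{x},\mathbf{u})}(\mathbf{v})\in\mathrm{T}_{\mathrm{R}^{\mathcal{M}}_{\mathbf{x}}(\mathbf{u})}\mathcal{M}$, linear in $\mathbf{v}$, with $\mathrm{VT}^{\mathcal{M}}_{(\mathbf{x},0)}(\mathbf{v})=\mathbf{v}$.
   Formalization: The lift R̂ is assumed smooth jointly in (x,V,Δ); ''sufficiently small'' means in a relatively open neighbourhood of the zero section; the retraction is defined on the open set of tangent vectors with Δ_x in it and rank Y = k, not on all of T(Gr_k(TM)). *)

(* Defs.v *)
From HB Require Import structures.
From mathcomp Require Import all_boot all_order all_algebra.
From mathcomp Require Import all_classical all_reals all_analysis.

Set Implicit Arguments.
Unset Strict Implicit.
Unset Printing Implicit Defensive.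
Import Order.TTheory GRing.Theory Num.Theory.
Import numFieldNormedType.Exports.
Local Open Scope classical_set_scope.
Local Open Scope ring_scope.

Section Calculus.
Variable R : realType.

Fixpoint iter_derive (V W : normedModType R) (vs : seq V) (f : V -> W) :
    V -> W :=
  if vs is v :: vs' then iter_derive vs' (fun x => 'D_v f x) else f.

(* All spaces used below are finite-dimensional, where this says that f is
   C^oo on the open set O. *)
Definition smooth_on (V W : normedModType R) (O : set V) (f : V -> W) : Prop :=
  open O /\ forall (vs : seq V) (x : V), O x ->
    differentiable (iter_derive vs f) x.

(* Smoothness of a map that matters only on an arbitrary subset A: local
   existence of smooth extensions to the ambient space. *)
Definition smooth_map (V W : normedModType R) (A : set V) (f : V -> W) : Prop :=
  forall a, A a -> exists (O : set V) (F : V -> W),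
    [/\ O a, smooth_on O F & forall x, O x -> A x -> F x = f x].

Definition curve_through (V : normedModType R) (A : set V) (x v : V)
    (c : R -> V) : Prop :=
  [/\ exists2 O : set R, O 0 & smooth_on O c,
      \forall t \near (0 : R), A (c t),
      c 0 = x
    & is_derive (0 : R) (1 : R) c v].

(* T_x A, as the set of velocities at x of smooth curves in A; a linear
   subspace of the ambient space when A is an embedded submanifold. *)
Definition tangent (V : normedModType R) (A : set V) (x : V) : set V :=
  [set v | exists c, curve_through A x v c].

Definition tangent_bundle (V : normedModType R) (A : set V) : set (V * V) :=
  [set q | A q.1 /\ tangent A q.1 q.2].

(* D f(x)[u] = w for f defined on A and u in T_x A. *)
Definition is_mdiff (V W : normedModType R) (A : set V) (f : V -> W)
    (x u : V) (w : W) : Prop :=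
  tangent A x u /\
  forall c, curve_through A x u c ->
    is_derive (0 : R) (1 : R) (fun t => f (c t)) w.

(* D f(x)[u]; it is the junk value 0 when f is not differentiable. *)
Definition mdiff (V W : normedModType R) (A : set V) (f : V -> W) (x u : V) : W :=
  xget 0 (is_mdiff A f x u).

Definition rel_open (T : topologicalType) (A U : set T) : Prop :=
  exists2 O : set T, open O & U = A `&` O.

(* Slice charts: near each of its points, M is straightened to
   R^d x {0} by a diffeomorphism between open subsets of R^n. *)
Definition embedded_submanifold (n d : nat) (M : set 'cV[R]_n) : Prop :=
  (d <= n)%N /\
  forall x, M x ->
    exists (O W : set 'cV[R]_n) (phi psi : 'cV[R]_n -> 'cV[R]_n),
      [/\ O x,
          smooth_on O phi /\ smooth_on W psi,
          (forall y, O y -> W (phi y) /\ psi (phi y) = y),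
          (forall z, W z -> O (psi z) /\ phi (psi z) = z)
        & forall y, O y ->
            (M y <-> forall i : 'I_n, (d <= i)%N -> phi y i 0 = 0)].

(* A retraction on N defined on a relatively open neighbourhood U of the zero
   section of TN; the case U = TN is the globally defined notion.  The
   differential of Rt y at 0 is that of a map on the fibre of U over y. *)
Definition retraction_on (V : normedModType R) (N : set V) (U : set (V * V))
    (Rt : V -> V -> V) : Prop :=
  [/\ rel_open (tangent_bundle N) U /\ (forall y, N y -> U (y, 0)),
      forall y u, U (y, u) -> N (Rt y u),
      smooth_map U (fun q => Rt q.1 q.2),
      forall y, N y -> Rt y 0 = y
    & forall y u, N y -> tangent N y u ->
        is_mdiff [set w | U (y, w)] (Rt y) 0 u u].

Definition retraction (V : normedModType R) (N : set V) (Rt : V -> V -> V) :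
    Prop :=
  retraction_on N (tangent_bundle N) Rt.

Definition vector_transport (V : normedModType R) (N : set V)
    (Rt : V -> V -> V) (VT : V -> V -> V -> V) : Prop :=
  [/\ smooth_map
        [set q : V * V * V |
          [/\ N q.1.1, tangent N q.1.1 q.1.2 & tangent N q.1.1 q.2]]
        (fun q => VT q.1.1 q.1.2 q.2),
      forall x u v, N x -> tangent N x u -> tangent N x v ->
        tangent N (Rt x u) (VT x u v),
      forall x u (a : R) v w, N x -> tangent N x u ->
        tangent N x v -> tangent N x w ->
        VT x u (a *: v + w) = a *: VT x u v + VT x u w
    & forall x v, N x -> tangent N x v -> VT x 0 v = v].

End Calculus.

Section Matrices.
Variable R : realType.

Definition is_orthproj n (S : set 'cV[R]_n) (P : 'M[R]_n) : Prop :=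
  [/\ P^T = P, P *m P = P & forall v, S v <-> P *m v = v].

(* Orthogonal projector onto the linear subspace S (junk value 0 otherwise). *)
Definition orthproj n (S : set 'cV[R]_n) : 'M[R]_n := xget 0 (is_orthproj S).

Definition normal n (S : set 'cV[R]_n) : set 'cV[R]_n :=
  [set w | forall v, S v -> v^T *m w = 0].

Definition Stiefel n (k : nat) (S : set 'cV[R]_n) : set 'M[R]_(n, k) :=
  [set V | V^T *m V = 1%:M /\ forall j, S (col j V)].

Definition Grassmann n (k : nat) (S : set 'cV[R]_n) : set 'M[R]_n :=
  [set P | [/\ P^T = P, P *m P = P, forall v, S (P *m v) & \rank P = k]].

Definition orthogonal_group (k : nat) : set 'M[R]_k :=
  [set Q | Q^T *m Q = 1%:M].

Definition is_sqrtmx k (A S : 'M[R]_k) : Prop :=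
  [/\ S^T = S, forall v : 'cV[R]_k, 0 <= (v^T *m S *m v) 0 0 & S *m S = A].

(* A^(-1/2), for A symmetric positive definite. *)
Definition invsqrtmx k (A : 'M[R]_k) : 'M[R]_k := invmx (xget 0 (is_sqrtmx A)).

Definition columnwise n k (f : 'cV[R]_n -> 'cV[R]_n) (Z : 'M[R]_(n, k)) :
    'M[R]_(n, k) :=
  \matrix_(i, j) f (col j Z) i 0.

End Matrices.

Arguments Stiefel {R n} k S _.
Arguments Grassmann {R n} k S _.

Section TangentGrassmann.
Variables (R : realType) (n : nat) (M : set 'cV[R]_n).

Definition tangent_proj (x : 'cV[R]_n) : 'M[R]_n := orthproj (tangent M x).

Definition second_ff (x u v : 'cV[R]_n) : 'cV[R]_n :=
  mdiff M tangent_proj x u *m v.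

Variable k : nat.

Definition St_bundle : set ('cV[R]_n * 'M[R]_(n, k)) :=
  [set q | M q.1 /\ Stiefel k (tangent M q.1) q.2].

Definition Gr_bundle : set ('cV[R]_n * 'M[R]_n) :=
  [set q | M q.1 /\ Grassmann k (tangent M q.1) q.2].

Definition St_to_Gr (q : 'cV[R]_n * 'M[R]_(n, k)) : 'cV[R]_n * 'M[R]_n :=
  (q.1, q.2 *m q.2^T).

(* T_P (Gr_k (T_x M)) *)
Definition tangent_Gr (x : 'cV[R]_n) (P : 'M[R]_n) : set 'M[R]_n :=
  tangent (Grassmann k (tangent M x)) P.

(* The triples (x, P, Delta) with (x, P) in Gr_k (T M) and
   Delta in T_P (Gr_k (T_x M)). *)
Definition vertical_bundle : set ('cV[R]_n * 'M[R]_n * 'M[R]_n) :=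
  [set q | Gr_bundle q.1 /\ tangent_Gr q.1.1 q.1.2 q.2].

(* The triples (x, V, Delta) with (x, V) in St_k (T M) and
   Delta in T_P (Gr_k (T_x M)) where P = V V^T. *)
Definition lift_bundle : set ('cV[R]_n * 'M[R]_(n, k) * 'M[R]_n) :=
  [set q | St_bundle q.1 /\ tangent_Gr q.1.1 (q.1.2 *m q.1.2^T) q.2].

Definition vertical_part (x : 'cV[R]_n) (Delta : 'M[R]_n) : 'M[R]_n :=
  tangent_proj x *m Delta *m tangent_proj x.

Section Formulas.
Variable VT : 'cV[R]_n -> 'cV[R]_n -> 'cV[R]_n -> 'cV[R]_n.
Variable Rhat : 'cV[R]_n -> 'M[R]_n -> 'M[R]_(n, k) -> 'M[R]_n -> 'M[R]_(n, k).
Variables (x : 'cV[R]_n) (P : 'M[R]_n) (V : 'M[R]_(n, k)).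
Variables (delta : 'cV[R]_n) (Delta : 'M[R]_n).

Definition Zmap : 'M[R]_(n, k) := Rhat x P V (vertical_part x Delta).

Definition Ymap : 'M[R]_(n, k) := columnwise (VT x delta) Zmap.

Definition Vtilde : 'M[R]_(n, k) := Ymap *m invsqrtmx (Ymap^T *m Ymap).

Definition Ptilde : 'M[R]_n := Vtilde *m Vtilde^T.

End Formulas.

(* The tangent vectors ((x, P), (delta, Delta)) of Gr_k (T M) at which the
   formula for the retraction is meaningful: the vertical part of Delta is
   small in the sense of D, and Y has full rank, so that (Y^T Y)^(-1/2) exists.
   It is the whole of T (Gr_k (T M)) when D is the whole vertical bundle and
   every VT x delta is injective on T_x M. *)
Definition Gr_domain
    (VT : 'cV[R]_n -> 'cV[R]_n -> 'cV[R]_n -> 'cV[R]_n)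
    (Rhat : 'cV[R]_n -> 'M[R]_n -> 'M[R]_(n, k) -> 'M[R]_n -> 'M[R]_(n, k))
    (D : set ('cV[R]_n * 'M[R]_n * 'M[R]_n)) :
    set (('cV[R]_n * 'M[R]_n) * ('cV[R]_n * 'M[R]_n)) :=
  [set q | let: ((x, P), (delta, Delta)) := q in
    [/\ tangent_bundle Gr_bundle q,
        D (x, P, vertical_part x Delta)
      & forall V : 'M[R]_(n, k), Stiefel k (tangent M x) V -> P = V *m V^T ->
          \rank (Ymap VT Rhat x P V delta Delta) = k]].

(* Rhat x P V is a map on T_P (Gr_k (T_x M)), for (x, V) in St_k (T M) and
   P = V V^T.  It is smooth jointly in all its arguments, and the relatively
   open neighbourhood D of the zero section of the vertical bundle makes
   precise "Delta sufficiently small": smoothness of each Rhat x P V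
   separately, or a size of Delta depending on (x, P) in an arbitrary way, would
   allow resulting maps on Gr_k (T M) that are not continuous, or not defined
   near the zero section. *)
Definition Gr_lift_family
    (Rhat : 'cV[R]_n -> 'M[R]_n -> 'M[R]_(n, k) -> 'M[R]_n -> 'M[R]_(n, k))
    (D : set ('cV[R]_n * 'M[R]_n * 'M[R]_n)) : Prop :=
  [/\ smooth_map lift_bundle
        (fun q => Rhat q.1.1 (q.1.2 *m q.1.2^T) q.1.2 q.2),
      rel_open vertical_bundle D /\
        (forall x P, Gr_bundle (x, P) -> D (x, P, 0))
    & forall x P V, Gr_bundle (x, P) -> Stiefel k (tangent M x) V ->
        P = V *m V^T ->
        Rhat x P V 0 = V /\
        forall Delta, D (x, P, Delta) ->
          [/\ (forall v, tangent M x (Rhat x P V Delta *m v)),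
              \rank (Rhat x P V Delta) = k,
              (forall Q, orthogonal_group Q ->
                 Rhat x P (V *m Q) Delta = Rhat x P V Delta *m Q)
            & let DR := mdiff (tangent_Gr x P) (Rhat x P V) 0 Delta in
              DR *m V^T + V *m DR^T = Delta]].

End TangentGrassmann.

Arguments St_bundle {R n} M k _.
Arguments Gr_bundle {R n} M k _.
Arguments Gr_lift_family {R n} M {k} Rhat D.
Arguments Gr_domain {R n} M {k} VT Rhat D _.
Arguments Vtilde {R n} M {k} VT Rhat x P V delta Delta.
Arguments Ptilde {R n} M {k} VT Rhat x P V delta Delta.

(* Main.v *)
(** In a smooth local orthonormal frame V of P (an inverse Cholesky factor makes
    the columns of P V0 orthonormal), Y depends smoothly on (x, P, delta, Delta),
    and V~ V~^T is the orthogonal projector Y (Y^T Y)^-1 Y^T onto its range.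
    Changing V to V Q changes Y to Y Q, so the projector does not depend on the
    frame, and no smoothness of the matrix square root is needed.  At the zero
    section Y = V, and Y has derivative Z' + Pi' V, where Pi' is the derivative
    of the tangent projector Pi along delta.  Since V^T Pi' V = 0 and
    Z' V^T + V Z'^T = Pi Delta Pi, the derivative of Y^T Y vanishes, and that of
    the projector is Pi Delta Pi + Pi' P + P Pi'.  Differentiating
    Pi(x) P = P = P Pi(x) along a curve of Gr_k(TM) shows that this is Delta. *)

Require Import Defs.
From HB Require Import structures.
From mathcomp Require Import all_boot all_order all_algebra.
From mathcomp Require Import spectral complex.
From mathcomp Require Import all_classical all_reals all_analysis.
Import Order.TTheory GRing.Theory Num.Theory.
Import numFieldNormedType.Exports.
Local Open Scope classical_set_scope.
Local Open Scope ring_scope.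

Set Implicit Arguments.
Unset Strict Implicit.
Unset Printing Implicit Defensive.

(** * Smooth maps between finite-dimensional spaces *)

(** The maps involved live on sets that are not open. Their smoothness is therefore shown through
    local extensions to the ambient space, which have to agree with them only on the set. Tangent
    vectors are velocities of curves, so differentials are computed along curves that stay in the
    set, where an extension may replace the map. The two cancellations at the zero section come from
    compressing by V. The columns of Pi' V are values of the second fundamental form on tangent
    vectors, hence normal, so V^T Pi' V = 0. Differentiating P P = P gives Delta P + P Delta =
    Delta, hence V^T Delta V = 0; compressing Z' V^T + V Z'^T = Pi Delta Pi by V then makes V^T Z'
    skew. The inverse square root is used only pointwise, and a root exists by diagonalizing Y^T Y
    over the complex numbers. Full rank of Y is the nonvanishing of a Gram determinant, which makes
    the domain of the retraction relatively open. *)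

Section Ck.
Context {R : realType}.
Implicit Types U V W : normedModType R.

Lemma near_eq_differentiable V W (f g : V -> W) x :
  (\near x, f x = g x) -> differentiable f x -> differentiable g x.
Proof.
move=> fg df; have [dfc /eqaddoP dfE] := (diff_locallyP x f).1 df.
have gE : g \o shift x = cst (g x) + 'd f x +o_ 0 id.
  apply/eqaddoP => e e0; have fE := dfE e e0.
  have fg0 : \forall y \near (0 : V), f (y + x) = g (y + x).
    have := fg; rewrite (near_shift 0 x); apply: filterS => y /=.
    by rewrite subr0.
  by apply: filterS2 fg0 fE => y fgy; rewrite /= !fctE /= fgy (nbhs_singleton fg).
have dgE := diff_unique dfc gE.
by apply/diff_locallyP; rewrite dgE.
Qed.

(* The iterated directional derivatives of order at most m are differentiable,
   so Ck 0 is differentiability rather than continuity. *)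
Fixpoint Ck m V W (O : set V) (f : V -> W) : Prop :=
  (forall x, O x -> differentiable f x) /\
  if m is m'.+1 then forall v, Ck m' O (fun x => 'D_v f x) else True.

Lemma Ck_differentiable m V W (O : set V) (f : V -> W) x :
  Ck m O f -> O x -> differentiable f x.
Proof. by case: m => [|m] [+ _]; apply. Qed.

(** Replaces lists of directions by an induction on the order: a product or a composite is
    differentiated once and the result is handed to the induction hypothesis. *)
Lemma smooth_onP V W (O : set V) (f : V -> W) :
  smooth_on O f <-> open O /\ forall m, Ck m O f.
Proof.
split=> -[oO sf]; split=> //.
  have {}sf (vs : seq V) m : Ck m O (iter_derive vs f).
    elim: m vs => [|m IH] vs /=; (split; first by move=> x; exact: sf) => // v.
    (* [iter_derive] differentiates along the head of the list first, so a further outer derivative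
       is appended at the end. *)
    have -> : (fun x => 'D_v (iter_derive vs f) x) = iter_derive (rcons vs v) f.
      by elim: vs f {sf IH} => //= w vs IH f; rewrite IH.
    exact: IH.
  exact: (sf [::]).
move=> vs x Ox; have := sf (size vs).
elim: vs f {sf} => [|v vs IH] f /= [sf1 sf2]; first exact: sf1.
exact: IH.
Qed.

Lemma Ck_ext m V W (O : set V) (f g : V -> W) : open O ->
  (forall x, O x -> f x = g x) -> Ck m O f -> Ck m O g.
Proof.
move=> oO; elim: m f g => [|m IH] f g fg /= [df sf]; split=> //.
- move=> x Ox; apply: near_eq_differentiable (df x Ox).
  by apply: filterS (open_nbhs_nbhs (conj oO Ox)) => y; exact: fg.
- move=> x Ox; apply: near_eq_differentiable (df x Ox).
  by apply: filterS (open_nbhs_nbhs (conj oO Ox)) => y; exact: fg.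
- move=> v; apply: IH (sf v) => x Ox; apply: near_eq_derive.
  by apply: filterS (open_nbhs_nbhs (conj oO Ox)) => y; exact: fg.
Qed.

Lemma Ck_subset m V W (O O' : set V) (f : V -> W) :
  O' `<=` O -> Ck m O f -> Ck m O' f.
Proof.
move=> OO'; elim: m f => [|m IH] f /= [df sf].
  by split=> // x /OO'; exact: df.
by split=> [x /OO'|v]; [exact: df|exact: IH].
Qed.

Lemma CkW m V W (O : set V) (f : V -> W) : Ck m.+1 O f -> Ck m O f.
Proof.
elim: m f => [|m IH] f [df sf]; split=> // v.
by apply: IH; exact: sf.
Qed.

Lemma Ck_cst m V W (O : set V) (w : W) : Ck m O (cst w : V -> W).
Proof.
elim: m w => [|m IH] w /=; split=> // v.
have -> : (fun x : V => 'D_v (cst w) x) = cst 0 by apply/funext => x; rewrite derive_cst.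
exact: IH.
Qed.

Lemma Ck_lin_comp m U V W (O : set U) (f : U -> V) (l : {linear V -> W}) :
  open O -> continuous l -> Ck m O f -> Ck m O (l \o f).
Proof.
move=> oO cl; elim: m f => [|m IH] f /= [df sf].
  split=> // x Ox; apply: differentiable_comp (df x Ox) _.
  exact: linear_differentiable.
split=> [x Ox|v].
  apply: differentiable_comp (df x Ox) _; exact: linear_differentiable.
apply: Ck_ext (IH _ (sf v)) => // x Ox /=.
have dl : differentiable l (f x) by exact: linear_differentiable.
have dlf : differentiable (l \o f) x by apply: differentiable_comp => //; exact: df.
rewrite [RHS]deriveE// diff_comp//=; last exact: df.
rewrite diff_lin// deriveE//; exact: df.
Qed.

Lemma Ck_id m V (O : set V) : Ck m O (id : V -> V).
Proof.
case: m => [|m] /=; split=> // v.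
have -> : (fun x : V => 'D_v id x) = cst v by apply/funext => x; rewrite derive_id.
exact: Ck_cst.
Qed.

Lemma CkD m V W (O : set V) (f g : V -> W) : open O ->
  Ck m O f -> Ck m O g -> Ck m O (fun x => f x + g x).
Proof.
move=> oO; elim: m f g => [|m IH] f g /= [df sf] [dg sg].
  by split=> // x Ox; apply: differentiableD; [exact: df|exact: dg].
split=> [x Ox|v]; first by apply: differentiableD; [exact: df|exact: dg].
apply: Ck_ext (IH _ _ (sf v) (sg v)) => // x Ox.
by rewrite [RHS]deriveD//; apply: diff_derivable; [exact: df|exact: dg].
Qed.

Lemma Ck_sum m V W (O : set V) (I : Type) (r : seq I) (P : pred I) (f : I -> V -> W) : open O ->
  (forall i, P i -> Ck m O (f i)) -> Ck m O (fun x => \sum_(i <- r | P i) f i x).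
Proof.
move=> oO sf; elim: r => [|i r IH].
  by apply: Ck_ext (Ck_cst m O 0) => // x Ox; rewrite big_nil.
case: (boolP (P i)) => Pi; last first.
  by apply: Ck_ext IH => // x Ox; rewrite big_cons (negbTE Pi).
by apply: Ck_ext (CkD oO (sf i Pi) IH) => // x Ox; rewrite big_cons Pi.
Qed.

Lemma CkM m V (O : set V) (f g : V -> R) : open O ->
  Ck m O f -> Ck m O g -> Ck m O (fun x => f x * g x).
Proof.
move=> oO; elim: m f g => [|m IH] f g.
  by move=> [df _] [dg _]; split=> // x Ox; apply: differentiableM; [exact: df|exact: dg].
move=> sf sg; split=> [x Ox|v].
  by apply: differentiableM; [exact: Ck_differentiable sf Ox|exact: Ck_differentiable sg Ox].
apply: (@Ck_ext _ _ _ _ (fun x => f x * 'D_v g x + 'D_v f x * g x)) => //.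
  move=> x Ox; rewrite [RHS]deriveM//.
  - by rewrite [g x *: _]mulrC.
  - by apply: diff_derivable; exact: Ck_differentiable sf Ox.
  - by apply: diff_derivable; exact: Ck_differentiable sg Ox.
apply: CkD => //; apply: IH; [exact: CkW|exact: sg.2|exact: sf.2|exact: CkW].
Qed.

End Ck.

(** Coordinates serve the chain rule: the derivative of g o f is that of g in a direction that
    varies with the point, and expanding this direction leaves finitely many derivatives in the
    fixed directions [e i]. *)
Class findim {R : realType} (V : normedModType R) : Prop := FinDim {
  findimP : exists (I : finType) (e : I -> V) (c : I -> {linear V -> R}),
    (forall i, continuous (c i)) /\ forall v, v = \sum_i c i v *: e i }.

Section Smooth.
Context {R : realType}.
Implicit Types U V W : normedModType R.

Global Instance findim_R : findim R.
Proof.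
split; exists unit, (fun=> 1), (fun=> idfun : {linear R -> R}); split.
  by move=> _ x; exact: cvg_id.
by move=> v; rewrite big_const /= card_unit /= addr0 [_%:A]mulr1.
Qed.

(** Here and below, coordinates, injections and projections are packaged as bundled continuous
    linear maps, so that their smoothness and derivatives all come from the linear case. *)
Lemma linear_coord m n i j : exists f : {linear 'M[R]_(m, n) -> R},
  continuous f /\ forall N, f N = N i j.
Proof.
have lf : linear (fun N : 'M[R]_(m, n) => N i j : R).
  by move=> a A B; rewrite !mxE.
pose fM := GRing.isLinear.Build _ _ _ _ _ lf.
pose f : {linear _ -> _} := HB.pack (fun N : 'M[R]_(m, n) => N i j : R) fM.
by exists f; split=> //; exact: coord_continuous.
Qed.

Global Instance findim_matrix m n : findim ('M[R]_(m, n)).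
Proof.
pose cl (i : 'I_m * 'I_n) := cid (linear_coord i.1 i.2).
split; exists ('I_m * 'I_n)%type, (fun i => delta_mx i.1 i.2), (fun i => sval (cl i)).
split=> [i|v]; first by case: (svalP (cl i)).
rewrite [LHS]matrix_sum_delta pair_bigA /=; apply: eq_bigr => i _.
by case: (svalP (cl i)) => _ ->.
Qed.

Lemma linear_pair1 U V : exists f : {linear U -> (U * V)%type},
  continuous f /\ forall x, f x = (x, 0).
Proof.
have lf : linear (fun x : U => (x, 0) : (U * V)%type).
  by move=> a x y; congr pair; rewrite /= scaler0 addr0.
pose fM := GRing.isLinear.Build _ _ _ _ _ lf.
pose f : {linear _ -> _} := HB.pack (fun x : U => (x, 0) : (U * V)%type) fM.
exists f; split=> // x; apply: cvg_pair; [exact: cvg_id|exact: cvg_cst].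
Qed.

Lemma linear_pair2 U V : exists f : {linear V -> (U * V)%type},
  continuous f /\ forall x, f x = (0, x).
Proof.
have lf : linear (fun x : V => (0, x) : (U * V)%type).
  by move=> a x y; congr pair; rewrite /= scaler0 addr0.
pose fM := GRing.isLinear.Build _ _ _ _ _ lf.
pose f : {linear _ -> _} := HB.pack (fun x : V => (0, x) : (U * V)%type) fM.
exists f; split=> // x; apply: cvg_pair; [exact: cvg_cst|exact: cvg_id].
Qed.

Lemma linear_fst U V : exists f : {linear (U * V)%type -> U},
  continuous f /\ forall x, f x = x.1.
Proof.
have lf : linear (fst : (U * V)%type -> U) by move=> a x y.
pose fM := GRing.isLinear.Build _ _ _ _ _ lf.
pose f : {linear _ -> _} := HB.pack (fst : (U * V)%type -> U) fM.
by exists f; split=> // x; exact: cvg_fst.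
Qed.

Lemma linear_snd U V : exists f : {linear (U * V)%type -> V},
  continuous f /\ forall x, f x = x.2.
Proof.
have lf : linear (snd : (U * V)%type -> V) by move=> a x y.
pose fM := GRing.isLinear.Build _ _ _ _ _ lf.
pose f : {linear _ -> _} := HB.pack (snd : (U * V)%type -> V) fM.
by exists f; split=> // x; exact: cvg_snd.
Qed.

Lemma linear_scalel V (w : V) : exists f : {linear R -> V},
  continuous f /\ forall k, f k = k *: w.
Proof.
have lf : linear (fun k : R => k *: w) by move=> a x y; rewrite scalerDl scalerA.
pose fM := GRing.isLinear.Build _ _ _ _ _ lf.
pose f : {linear _ -> _} := HB.pack (fun k : R => k *: w) fM.
by exists f; split=> //; exact: scalel_continuous.
Qed.

Global Instance findim_prod U V : findim U -> findim V -> findim (U * V)%type.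
Proof.
move=> [[I [e [c [cc cE]]]]] [[J [e' [c' [cc' cE']]]]]; split.
have [p1 [p1c p1E]] := linear_fst U V.
have [p2 [p2c p2E]] := linear_snd U V.
exists (I + J)%type, (fun i => match i with inl i => (e i, 0) | inr j => (0, e' j) end).
exists (fun i => match i with inl i => (c i \o p1)%FUN : {linear _ -> _}
                         | inr j => (c' j \o p2)%FUN : {linear _ -> _} end).
split=> [[i|j]|[u v]].
- by move=> x; apply: continuous_comp; [exact: p1c|exact: cc].
- by move=> x; apply: continuous_comp; [exact: p2c|exact: cc'].
rewrite big_sumType /=.
have [i1 [_ i1E]] := linear_pair1 U V; have [i2 [_ i2E]] := linear_pair2 U V.
have -> : (u, v) = i1 u + i2 v by rewrite i1E i2E; congr pair; rewrite /= ?addr0 ?add0r.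
have -> : p1 (i1 u + i2 v) = u by rewrite p1E i1E i2E /= addr0.
have -> : p2 (i1 u + i2 v) = v by rewrite p2E i1E i2E /= add0r.
rewrite {1}[u]cE {1}[v]cE' !linear_sum; congr (_ + _);
  by apply: eq_bigr => i _; rewrite linearZ /= ?i1E ?i2E.
Qed.

Lemma CkZl m V W (O : set V) (k : V -> R) (w : W) : open O ->
  Ck m O k -> Ck m O (fun x => k x *: w).
Proof.
move=> oO sk; have [l [lc lE]] := linear_scalel w.
by apply: Ck_ext (Ck_lin_comp oO lc sk) => // x _; rewrite /= lE.
Qed.

Lemma Ck_compR m U V (O : set U) (O' : set V) (f : U -> V) (g : V -> R) :
  findim V -> open O -> open O' -> (forall x, O x -> O' (f x)) ->
  Ck m O f -> Ck m O' g -> Ck m O (g \o f).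
Proof.
move=> [[I [e [c [cc cE]]]]] oO oO' OO'; elim: m g f OO' => [|m IH] g f OO' sf sg.
  split=> // x Ox; apply: differentiable_comp.
    exact: Ck_differentiable sf Ox.
  exact: Ck_differentiable sg (OO' _ Ox).
split=> [x Ox|v].
  apply: differentiable_comp.
    exact: Ck_differentiable sf Ox.
  exact: Ck_differentiable sg (OO' _ Ox).
apply: (@Ck_ext _ _ _ _ _
  (fun x => \sum_i c i ('D_v f x) * 'D_(e i) g (f x))) => // [x Ox|].
  have df := Ck_differentiable sf Ox; have dg := Ck_differentiable sg (OO' _ Ox).
  rewrite [RHS]deriveE; last exact: differentiable_comp.
  rewrite diff_comp//= -(deriveE v df) [X in _ = 'd g _ X]cE linear_sum.
  by apply: eq_bigr => i _; rewrite linearZ /= (deriveE (e i) dg).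
apply: Ck_sum => // i _; apply: CkM => //.
  exact: Ck_lin_comp oO (cc i) (sf.2 v).
exact: IH (fun x => 'D_(e i) g x) f OO' (CkW sf) (sg.2 (e i)).
Qed.

Lemma Ck_comp m U V W (O : set U) (O' : set V) (f : U -> V) (g : V -> W) :
  findim V -> findim W -> open O -> open O' -> (forall x, O x -> O' (f x)) ->
  Ck m O f -> Ck m O' g -> Ck m O (g \o f).
Proof.
move=> fV [[I [e [c [cc cE]]]]] oO oO' OO' sf sg.
apply: (@Ck_ext _ _ _ _ _ (fun x => \sum_i (c i \o g \o f) x *: e i)) => //.

apply: Ck_sum => // i _; apply: CkZl => //; apply: Ck_compR OO' sf _ => //.
exact: Ck_lin_comp.
Qed.

(** The derivative is a constant times the square of the inverse, so the induction closes on
    itself. *)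
Lemma Ck_inv m : Ck m [set x : R | x != 0] (GRing.inv : R -> R).
Proof.
have o0 : open [set x : R | x != 0] by exact: open_neq.
elim: m => [|m IH]; (split; first by move=> x /= x0; exact: differentiable_Rinv) => // v.
apply: (@Ck_ext R m R R _ (fun x => (- v) * (x^-1 * x^-1))) => //.
  move=> x /= x0; rewrite [RHS]deriveE; last exact: differentiable_Rinv.
  by rewrite diff_Rinv// expr2 invfM /GRing.scale/= mulNr mulNr mulrC.
by apply: CkM => //; [exact: Ck_cst|exact: CkM].
Qed.

(** The derivative is the inverse of 2 sqrt x up to a constant: order m of the root and [Ck_inv]
    give order m + 1. *)
Lemma Ck_sqrt m : Ck m [set x : R | 0 < x] (Num.sqrt : R -> R).
Proof.
have o0 : open [set x : R | 0 < x] by exact: open_gt.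
have dsqrt (x : R) : 0 < x -> differentiable (Num.sqrt : R -> R) x.
  by move=> x0; apply/derivable1_diffP; exact: (@ex_derive _ _ _ _ _ _ _ (is_derive1_sqrt x0)).
elim: m => [|m IH]; (split; first by move=> x /= x0; exact: dsqrt) => // v.
apply: (@Ck_ext R m R R _ (fun x => v * (2 * Num.sqrt x)^-1)) => //.
  move=> x /= x0; rewrite [RHS]deriveE//; last exact: dsqrt.
  rewrite -[v in RHS]mulr1 [X in 'd _ _ X](_ : _ = v *: (1 : R))// linearZ /=.
  rewrite -deriveE; last exact: dsqrt.
  by have := @derive_val _ _ _ _ _ _ _ (is_derive1_sqrt x0) => ->.
apply: CkM => //; first exact: Ck_cst.
have oR : open [set x : R | x != 0] by exact: open_neq.
refine (Ck_compR (f := fun x : R => 2 * Num.sqrt x) findim_R o0 oR _ _ (Ck_inv m)).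
- by move=> x /= x0; rewrite mulf_neq0// ?pnatr_eq0// gt_eqF// sqrtr_gt0.
- by apply: CkM => //; exact: Ck_cst.
Qed.

End Smooth.

(** Smoothness on a whole neighbourhood of the point, hence inherited by directional derivatives. *)
Definition smooth_at {R : realType} {V W : normedModType R} (f : V -> W) (a : V) :=
  exists2 O : set V, O a & smooth_on O f.

Section SmoothAt.
Context {R : realType}.
Implicit Types U V W : normedModType R.

(** Shrinking the open set to the interior of the agreement set lets an extension be described by
    conditions that hold only near the point. *)
Lemma smooth_mapP V W (A : set V) (f : V -> W) :
  smooth_map A f <-> forall a, A a -> exists F : V -> W,
    smooth_at F a /\ \forall x \near a, A x -> F x = f x.
Proof.
split=> sf a Aa; move: (sf a Aa).
  move=> [B0 [F [Oa sF FE]]]; exists F; split; first by exists B0.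
  by apply: filterS (open_nbhs_nbhs (conj sF.1 Oa)) => x Ox; exact: FE.
move=> [F [ [ O Oa /smooth_onP[oO sF]] FE]].
exists (O `&` (interior [set x | A x -> F x = f x])), F; split=> //.
- apply/smooth_onP; split; first by apply: openI => //; exact: open_interior.
  by move=> m; apply: Ck_subset (sF m) => x [].
- by move=> x [_ /interior_subset].
Qed.

Lemma smooth_at_differentiable V W (f : V -> W) a : smooth_at f a -> differentiable f a.
Proof. by move=> [ O Oa [_ /(_ [::])]]; exact. Qed.

Lemma smooth_at_continuous V W (f : V -> W) a : smooth_at f a -> {for a, continuous f}.
Proof. by move=> /smooth_at_differentiable; exact: differentiable_continuous. Qed.

Lemma near_smooth_at V W (f : V -> W) a (P : W -> Prop) : smooth_at f a ->
  (\forall y \near f a, P y) -> \forall x \near a, P (f x).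
Proof. by move=> /smooth_at_continuous; exact. Qed.

Lemma smooth_at_near_eq V W (f g : V -> W) a :
  (\forall x \near a, f x = g x) -> smooth_at f a -> smooth_at g a.
Proof.
move=> fg [ O Oa /smooth_onP[oO sf]].
exists (O `&` interior [set x | f x = g x]); first by split.
have oI : open (O `&` interior [set x | f x = g x]).
  by apply: openI => //; exact: open_interior.
apply/smooth_onP; split=> // m; apply: Ck_ext (Ck_subset _ (sf m)) => //.
by move=> x [_ /interior_subset].
Qed.

Lemma smooth_at_ext V W (f g : V -> W) a :
  f =1 g -> smooth_at f a -> smooth_at g a.
Proof. by move=> fg; apply: smooth_at_near_eq; near do exact: fg.
Unshelve. all: by end_near. Qed.

Lemma smooth_at_derive V W (f : V -> W) a v :
  smooth_at f a -> smooth_at (fun x => 'D_v f x) a.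
Proof. by move=> [ O Oa [oO sf]]; exists O => //; split=> // vs; exact: (sf (v :: vs)). Qed.

Lemma smooth_at_cst V W (w : W) (a : V) : smooth_at (fun=> w) a.
Proof.
exists setT => //; apply/smooth_onP; split; first exact: openT.
by move=> m; exact: Ck_cst.
Qed.

Lemma smooth_at_id V (a : V) : smooth_at id a.
Proof.
exists setT => //; apply/smooth_onP; split; first exact: openT.
by move=> m; exact: Ck_id.
Qed.

Lemma smooth_at_comp U V W (f : U -> V) (g : V -> W) a :
  findim V -> findim W ->
  smooth_at f a -> smooth_at g (f a) -> smooth_at (fun x => g (f x)) a.
Proof.
move=> fV fW [ O Oa /smooth_onP[oO sf]] [ O' Oa' /smooth_onP[oO' sg]].
have oI : open (O `&` f @^-1` O').
  rewrite openE => x [Ox Ofx]; apply: filterI; first exact: open_nbhs_nbhs.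
  have : {for x, continuous f}.
    by apply: differentiable_continuous; exact: (Ck_differentiable (sf 0%N)).
  by apply; exact: open_nbhs_nbhs.
exists (O `&` f @^-1` O') => //.
apply/smooth_onP; split=> // m; apply: Ck_comp (sg m) => //.
  by move=> x [].
by apply: Ck_subset (sf m) => x [].
Qed.

Lemma smooth_at_linear U V W (l : {linear V -> W}) (f : U -> V) a :
  continuous l -> smooth_at f a -> smooth_at (fun x => l (f x)) a.
Proof.
move=> cl [ O Oa /smooth_onP[oO sf]]; exists O => //; apply/smooth_onP; split=> // m.
exact: Ck_lin_comp.
Qed.

Lemma smooth_at_fst U V W (f : U -> (V * W)%type) a :
  smooth_at f a -> smooth_at (fun x => (f x).1) a.
Proof.
have [l [cl lE]] := linear_fst V W; move=> /(smooth_at_linear cl).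
by apply: smooth_at_ext => x; rewrite lE.
Qed.

Lemma smooth_at_snd U V W (f : U -> (V * W)%type) a :
  smooth_at f a -> smooth_at (fun x => (f x).2) a.
Proof.
have [l [cl lE]] := linear_snd V W; move=> /(smooth_at_linear cl).
by apply: smooth_at_ext => x; rewrite lE.
Qed.

Lemma smooth_atD U V (f g : U -> V) a : smooth_at f a -> smooth_at g a ->
  smooth_at (fun x => f x + g x) a.
Proof.
move=> [ O Oa /smooth_onP[oO sf]] [ O' Oa' /smooth_onP[oO' sg]].
exists (O `&` O') => //; apply/smooth_onP; split=> [|m]; first exact: openI.
apply: CkD; first exact: openI.
  by apply: Ck_subset (sf m) => x [].
by apply: Ck_subset (sg m) => x [].
Qed.

Lemma smooth_at_sum (I : Type) (r : seq I) (P : pred I) U V (f : I -> U -> V) a :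
  (forall i, P i -> smooth_at (f i) a) -> smooth_at (fun x => \sum_(i <- r | P i) f i x) a.
Proof.
move=> sf; elim: r => [|i r IH].
  by apply: smooth_at_ext (smooth_at_cst 0 a) => x; rewrite big_nil.
case: (boolP (P i)) => Pi; last first.
  by apply: smooth_at_ext IH => x; rewrite big_cons (negbTE Pi).
by apply: smooth_at_ext (smooth_atD (sf i Pi) IH) => x; rewrite big_cons Pi.
Qed.

Lemma smooth_at_pair U V W (f : U -> V) (g : U -> W) a :
  smooth_at f a -> smooth_at g a -> smooth_at (fun x => (f x, g x)) a.
Proof.
have [l [cl lE]] := linear_pair1 V W; have [l' [cl' lE']] := linear_pair2 V W.
move=> /(smooth_at_linear cl) sf /(smooth_at_linear cl') sg.
apply: smooth_at_ext (smooth_atD sf sg) => x; rewrite lE lE'.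
by congr pair; rewrite /= ?addr0 ?add0r.
Qed.

Lemma smooth_atM U (f g : U -> R) a : smooth_at f a -> smooth_at g a ->
  smooth_at (fun x => f x * g x) a.
Proof.
move=> [ O Oa /smooth_onP[oO sf]] [ O' Oa' /smooth_onP[oO' sg]].
exists (O `&` O') => //; apply/smooth_onP; split=> [|m]; first exact: openI.
apply: CkM; first exact: openI.
  by apply: Ck_subset (sf m) => x [].
by apply: Ck_subset (sg m) => x [].
Qed.

Lemma smooth_at_prod (I : Type) (r : seq I) (P : pred I) U (f : I -> U -> R) a :
  (forall i, P i -> smooth_at (f i) a) -> smooth_at (fun x => \prod_(i <- r | P i) f i x) a.
Proof.
move=> sf; elim: r => [|i r IH].
  by apply: smooth_at_ext (smooth_at_cst (1 : R) a) => x; rewrite big_nil.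
case: (boolP (P i)) => Pi; last first.
  by apply: smooth_at_ext IH => x; rewrite big_cons (negbTE Pi).
by apply: smooth_at_ext (smooth_atM (sf i Pi) IH) => x; rewrite big_cons Pi.
Qed.

Lemma smooth_atV U (f : U -> R) a : smooth_at f a -> f a != 0 ->
  smooth_at (fun x => (f x)^-1) a.
Proof.
move=> sf fa0; apply: smooth_at_comp sf _.
exists [set x | x != 0] => //; apply/smooth_onP; split; first exact: open_neq.
exact: Ck_inv.
Qed.

Lemma smooth_at_sqrt U (f : U -> R) a : smooth_at f a -> 0 < f a ->
  smooth_at (fun x => Num.sqrt (f x)) a.
Proof.
move=> sf fa0; apply: smooth_at_comp sf _.
exists [set x | 0 < x] => //; apply/smooth_onP; split; first exact: open_gt.
exact: Ck_sqrt.
Qed.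

Lemma smooth_at_coord U m n (F : U -> 'M[R]_(m, n)) a i j :
  smooth_at F a -> smooth_at (fun x => F x i j : R) a.
Proof.
have [l [cl lE]] := @linear_coord R m n i j; move=> /(smooth_at_linear cl).
by apply: smooth_at_ext => x; rewrite lE.
Qed.

Lemma smooth_at_mx U m n (F : U -> 'M[R]_(m, n)) a :
  (forall i j, smooth_at (fun x => F x i j : R) a) -> smooth_at F a.
Proof.
move=> sF; apply: (@smooth_at_ext _ _ (fun x => \sum_i \sum_j F x i j *: delta_mx i j)).
  by move=> x; rewrite -matrix_sum_delta.
apply: smooth_at_sum => i _; apply: smooth_at_sum => j _.
have [l [cl lE]] := linear_scalel (delta_mx i j : 'M[R]_(m, n)).
by apply: smooth_at_ext (smooth_at_linear cl (sF i j)) => x; rewrite lE.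
Qed.

Lemma smooth_at_mulmx U m n p (A : U -> 'M[R]_(m, n)) (B : U -> 'M[R]_(n, p)) a :
  smooth_at A a -> smooth_at B a -> smooth_at (fun x => A x *m B x) a.
Proof.
move=> sA sB; apply: smooth_at_mx => i j.
apply: (@smooth_at_ext _ _ (fun x => \sum_k A x i k * B x k j)).
  by move=> x; rewrite mxE.
by apply: smooth_at_sum => k _; apply: smooth_atM; exact: smooth_at_coord.
Qed.

Lemma smooth_at_scalemx U m n (k : U -> R) (A : U -> 'M[R]_(m, n)) a :
  smooth_at k a -> smooth_at A a -> smooth_at (fun x => k x *: A x) a.
Proof.
move=> sk sA; apply: smooth_at_mx => i j.
apply: (@smooth_at_ext _ _ (fun x => k x * A x i j)); first by move=> x; rewrite mxE.
by apply: smooth_atM => //; exact: smooth_at_coord.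
Qed.

Lemma smooth_at_trmx U m n (A : U -> 'M[R]_(m, n)) a :
  smooth_at A a -> smooth_at (fun x => (A x)^T) a.
Proof.
move=> sA; apply: smooth_at_mx => i j.
by apply: smooth_at_ext (smooth_at_coord j i sA) => x; rewrite mxE.
Qed.

Lemma smooth_at_col U m n (A : U -> 'M[R]_(m, n)) j a :
  smooth_at A a -> smooth_at (fun x => col j (A x)) a.
Proof.
move=> sA; apply: smooth_at_mx => i k.
by apply: smooth_at_ext (smooth_at_coord i j sA) => x; rewrite mxE.
Qed.

Lemma smooth_at_det U n (A : U -> 'M[R]_n) a :
  smooth_at A a -> smooth_at (fun x => \det (A x)) a.
Proof.
move=> sA; apply: smooth_at_sum => s _; apply: smooth_atM; first exact: smooth_at_cst.
by apply: smooth_at_prod => i _; exact: smooth_at_coord.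
Qed.

Lemma smooth_at_invmx U n (A : U -> 'M[R]_n) a :
  smooth_at A a -> A a \in unitmx -> smooth_at (fun x => invmx (A x)) a.
Proof.
move=> sA uA; have sd := smooth_at_det sA.
have dA0 : \det (A a) != 0 by move: uA; rewrite unitmxE unitfE.
(* Cramer's rule, valid only where the determinant is nonzero; elsewhere [invmx] takes a default
   value, so the equality is local. *)
apply: (@smooth_at_near_eq _ _ (fun x => (\det (A x))^-1 *: \adj (A x))).
  have : \forall x \near a, \det (A x) != 0.
    have /(_ [set y : R | y != 0]) := smooth_at_continuous sd; apply.
    by apply: open_nbhs_nbhs; split=> //; exact: open_neq.
  by apply: filterS => x d0; rewrite /invmx unitmxE unitfE d0.
apply: smooth_at_scalemx; first exact: smooth_atV.
apply: smooth_at_mx => i j.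
apply: (@smooth_at_ext _ _ (fun x => (-1) ^+ (j + i) * \det (row' j (col' i (A x))))).
  by move=> x; rewrite mxE.
apply: smooth_atM; first exact: smooth_at_cst.
apply: smooth_at_det; apply: smooth_at_mx => i' j'.
by apply: smooth_at_ext (smooth_at_coord (lift j i') (lift i j') sA) => x; rewrite !mxE.
Qed.

(** * Derivatives along curves and of matrix products *)

Lemma is_derive_curve V W (F : V -> W) (c : R -> V) (t : R) (v : V) :
  is_derive t (1 : R) c v -> differentiable F (c t) ->
  is_derive t (1 : R) (fun s => F (c s)) ('D_v F (c t)).
Proof.
move=> [dc cE] dF; have {}dc : differentiable c t by apply/derivable1_diffP.
have dFc : differentiable (F \o c) t by exact: differentiable_comp.
split; first exact: diff_derivable.
by rewrite (deriveE _ dFc) (diff_comp dc dF) /= -(deriveE _ dc) cE (deriveE _ dF).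
Qed.

Lemma is_derive_mxP V m n (F : V -> 'M[R]_(m, n)) t v dF :
  is_derive t v F dF <-> forall i j, is_derive t v (fun x => F x i j : R) (dF i j : R).
Proof.
split=> [[dFt <-] i j|dFt].
  have dF' := (derivable_mxP F t v).1 dFt.
  by split; [exact: dF'|rewrite derive_mx// mxE].
have dFt' : derivable F t v by apply/derivable_mxP => i j; case: (dFt i j).
by split=> //; rewrite derive_mx//; apply/matrixP => i j; rewrite mxE; case: (dFt i j).
Qed.

Lemma is_derive_mulmx V m n p (A : V -> 'M[R]_(m, n)) (B : V -> 'M[R]_(n, p)) t v dA dB :
  is_derive t v A dA -> is_derive t v B dB ->
  is_derive t v (fun x => A x *m B x) (dA *m B t + A t *m dB).
Proof.
move=> /is_derive_mxP dA' /is_derive_mxP dB'; apply/is_derive_mxP => i j.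
have -> : (fun x => (A x *m B x) i j) = \sum_k (fun x => A x i k * B x k j).
  by apply/funext => x; rewrite mxE fct_sumE.
rewrite !mxE -big_split /=; apply: is_derive_sum => k.
have := @is_deriveM _ _ _ _ _ _ _ _ (dA' i k) (dB' k j).
by rewrite /GRing.scale /= addrC [B t k j * _]mulrC.
Qed.

Lemma is_derive_trmx V m n (A : V -> 'M[R]_(m, n)) t v dA :
  is_derive t v A dA -> is_derive t v (fun x => (A x)^T) dA^T.
Proof.
move=> /is_derive_mxP dA'; apply/is_derive_mxP => i j.
have -> : (fun x => (A x)^T i j) = (fun x => A x j i) by apply/funext => x; rewrite mxE.
by rewrite mxE; exact: dA'.
Qed.

Lemma is_derive_unique V W (f : V -> W) t v w w' :
  is_derive t v f w -> is_derive t v f w' -> w = w'.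
Proof. by move=> [_ <-] [_ <-]. Qed.

Lemma is_derive_linear V W (l : {linear V -> W}) (c : R -> V) t v :
  continuous l -> is_derive t (1 : R) c v -> is_derive t (1 : R) (fun s => l (c s)) (l v).
Proof.
move=> cl dc; have dl : differentiable l (c t) by exact: linear_differentiable.
by have := is_derive_curve dc dl; rewrite deriveE// diff_lin.
Qed.

Lemma is_derive_fst V W (c : R -> (V * W)%type) t v :
  is_derive t (1 : R) c v -> is_derive t (1 : R) (fun s => (c s).1) v.1.
Proof.
have [l [cl lE]] := linear_fst V W; move=> /(is_derive_linear cl).
by rewrite lE; under eq_fun do rewrite lE.
Qed.

Lemma is_derive_snd V W (c : R -> (V * W)%type) t v :
  is_derive t (1 : R) c v -> is_derive t (1 : R) (fun s => (c s).2) v.2.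
Proof.
have [l [cl lE]] := linear_snd V W; move=> /(is_derive_linear cl).
by rewrite lE; under eq_fun do rewrite lE.
Qed.

Lemma is_derive_pair V W (c : R -> V) (c' : R -> W) t v v' :
  is_derive t (1 : R) c v -> is_derive t (1 : R) c' v' ->
  is_derive t (1 : R) (fun s => (c s, c' s)) (v, v').
Proof.
have [l [cl lE]] := linear_pair1 V W; have [l' [cl' lE']] := linear_pair2 V W.
move=> /(is_derive_linear cl) dc /(is_derive_linear cl') dc'.
have := is_deriveD dc dc'; rewrite lE lE'.
have -> : (v, 0) + (0, v') = (v, v') :> (V * W)%type.
  by congr pair; rewrite /= ?addr0 ?add0r.
congr is_derive; apply/funext => s; rewrite fctE lE lE'.
by congr pair; rewrite /= ?addr0 ?add0r.
Qed.

End SmoothAt.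

(** * Square roots and orthonormalization *)

Section PsdSqrt.
Variable R : rcfType.

(** Newton's induction: the correction term is a multiple of a polynomial vanishing at the earlier
    nodes. It lets a root of a matrix be written as a polynomial in that matrix. *)
Lemma interpolation (s : seq R) (f : R -> R) :
  exists p : {poly R}, forall x, x \in s -> p.[x] = f x.
Proof.
elim: s => [|a s [p pE]]; first by exists 0.
have [as_|as_] := boolP (a \in s).
  by exists p => x; rewrite inE => /predU1P[->|]; exact: pE.
pose q := \prod_(b <- s) ('X - b%:P).
have qa : q.[a] != 0.
  rewrite horner_prod prodf_seq_neq0; apply/allP => b bs /=.
  by rewrite hornerXsubC subr_eq0; apply: contraNneq as_ => ->.
exists (p + ((f a - p.[a]) / q.[a])%:P * q) => x; rewrite inE !hornerE => /predU1P[->|xs].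
  by rewrite divfK// addrC subrK.
have -> : q.[x] = 0; last by rewrite mulr0 addr0 pE.
by apply/eqP; rewrite -[_ == 0]/(root q x) root_prod_XsubC.
Qed.

(** Polynomials commute with conjugation and act entrywise on a diagonal matrix, so only the
    eigenvalues matter. *)
Lemma horner_mx_fourth_root (C : numClosedFieldType) k (U : 'M[C]_k.+1)
    (e : 'rV[C]_k.+1) (p : {poly C}) (A := invmx U *m diag_mx e *m U) :
  U \in unitmx -> (forall i, p.[e 0 i] ^+ 4 = e 0 i) -> horner_mx A p ^+ 4 = A.
Proof.
move=> uU pE; rewrite -rmorphXn /= /A horner_mx_uconjC// horner_mx_diag.
by congr (_ *m diag_mx _ *m _); apply/rowP => i; rewrite mxE horner_exp pE.
Qed.

(* The fourth root is a polynomial in A, hence symmetric; it is taken so that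
   the square root of A comes as the square of a symmetric matrix. *)
Lemma gram_fourth_root m k (Y : 'M[R]_(m, k)) :
  exists2 T : 'M[R]_k, T^T = T & (T *m T) *m (T *m T) = Y^T *m Y.
Proof.
case: k Y => [|k] Y; first by exists 0; apply/matrixP => -[].
set A := Y^T *m Y.
have At : A^T = A by rewrite /A trmx_mul trmxK.
pose toC := real_complex R.
pose AC := map_mx toC A; pose U := spectralmx AC; pose d := spectral_diag AC.
have Uu : U \is unitarymx := spectral_unitarymx AC.
have Uun : U \in unitmx by exact: unitarymx_unit.
have toC_real (x : R) : toC x \is Num.real.
  rewrite realE /toC !lecE /= eqxx /=; exact: le_total.
have ACh : AC \is hermsymmx.
  apply: realsym_hermsym; last by apply/mxOverP => i j; rewrite mxE toC_real.
  by apply/is_hermitianmxP; rewrite expr0 scale1r map_mx_id// map_trmx At.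
have dreal : d \is a mxOver Num.real := hermitian_spectral_diag_real ACh.
have ACE : AC = invmx U *m diag_mx d *m U.
  by apply/orthomx_spectralP; exact: hermitian_normalmx.
clearbody U d.
have dE i : d 0 i = toC (complex.Re (d 0 i)).
  have : d 0 i \is Num.real by exact: (mxOverP dreal).
  rewrite realE !lecE /=; case: (d 0 i) => u v /=.
  by move=> /orP[] /andP[/eqP vE _]; rewrite /toC /real_complex_def ?vE // -vE.
(* The diagonal matrix is itself a Gram matrix, that of Y times the conjugate transpose of U, so its
   entries are sums of squared moduli. *)
have d_ge0 i : 0 <= complex.Re (d 0 i).
  pose W := map_mx toC Y *m (map_mx Num.conj U^T).
  have WE : diag_mx d = (map_mx Num.conj W^T) *m W.
    have YC : map_mx Num.conj (map_mx toC Y) = map_mx toC Y.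
      by apply/realmxC/mxOverP => a b; rewrite mxE toC_real.
    rewrite /W trmx_mul map_mxM -!map_trmx YC trmxK -map_mx_comp (map_mx_id (@conjCK _)).
    rewrite mulmxA -[in RHS](mulmxA U) [(map_mx toC Y)^T]map_trmx -map_mxM -/A -/AC {1}ACE.
    by rewrite [(map_mx _ U)^T]map_trmx -invmx_unitary// !mulmxA mulmxV// mul1mx mulmxK.
  have : 0 <= d 0 i.
    have := congr1 (fun M : 'M[_]_k.+1 => M i i) WE; rewrite !mxE eqxx mulr1n => ->.
    by apply: sumr_ge0 => j _; rewrite !mxE mulrC mul_conjC_ge0.
  by rewrite {1}dE /toC lecE /= => /andP[].
(* Interpolation takes place over R, so the root is real although A is diagonalized over the complex
   numbers. *)
have [p pE] := interpolation [seq complex.Re (d 0 i) | i : 'I_k.+1]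
  (fun x => Num.sqrt (Num.sqrt x)).
pose T := horner_mx A p; exists T.
  rewrite /T; elim/poly_ind: (p) => [|q c IH]; first by rewrite rmorph0 trmx0.
  rewrite rmorphD rmorphM /= horner_mx_X horner_mx_C linearD /= tr_scalar_mx trmx_mul At IH.
  by congr (_ + _); exact: comm_mx_horner.
apply: (map_mx_inj (f := toC)); rewrite -/A.
have -> : (T *m T) *m (T *m T) = horner_mx A p ^+ 4 by rewrite -[4%N]/(2 * 2)%N exprM !expr2.
have -> : map_mx toC (horner_mx A p ^+ 4) = horner_mx AC (map_poly toC p) ^+ 4.
  by rewrite rmorphXn /= map_horner_mx.
rewrite [in LHS]ACE [RHS]ACE; apply: horner_mx_fourth_root => // i.
rewrite dE horner_map -rmorphXn; congr toC.
rewrite pE; last by apply/mapP; exists i => //; rewrite mem_enum.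
by rewrite -[4%N]/(2 * 2)%N exprM !sqr_sqrtr// sqrtr_ge0.
Qed.

End PsdSqrt.

(** * Gram matrices, full rank and orthonormalization *)

Section MatrixFacts.
Context {R : realType}.

(** Guarantees that the [xget] in [invsqrtmx] picks a genuine root. The witness is the square of a
    symmetric T, so its quadratic form at v is the squared norm of T v. *)
Lemma is_sqrtmx_gram m k (Y : 'M[R]_(m, k)) :
  is_sqrtmx (Y^T *m Y) (xget 0 (is_sqrtmx (Y^T *m Y))).
Proof.
have [T Tt TE] := gram_fourth_root Y.
apply: (@xgetPex _ 0 (is_sqrtmx (Y^T *m Y))); exists (T *m T); split=> //.
- by rewrite trmx_mul Tt.
move=> v; have -> : v^T *m (T *m T) *m v = (T *m v)^T *m (T *m v).
  by rewrite trmx_mul Tt !mulmxA.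
by rewrite mxE sumr_ge0// => i _; rewrite mxE -expr2 sqr_ge0.
Qed.

Lemma gram_eq0 m p (X : 'M[R]_(m, p)) : X^T *m X = 0 -> X = 0.
Proof.
move=> X0; apply/matrixP => i j; rewrite [RHS]mxE; apply/eqP; rewrite -sqrf_eq0.
have := congr1 (fun A : 'M[R]_p => A j j) X0; rewrite !mxE => /eqP.
rewrite psumr_eq0; last by move=> l _; rewrite mxE -expr2 sqr_ge0.
by move=> /allP/(_ i (mem_index_enum i)) /=; rewrite mxE -expr2.
Qed.

(** If K Y^T Y = 0, then K Y^T times its transpose vanishes, hence K Y^T = 0 over the reals. Full
    column rank thus becomes a condition on a determinant. *)
Lemma gram_unitmx m k (Y : 'M[R]_(m, k)) : (Y^T *m Y \in unitmx) = (\rank Y == k).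
Proof.
apply/idP/eqP => [u|rY].
  apply/eqP; rewrite eqn_leq rank_leq_col /=.
  by rewrite -{1}(mxrank_unit u) mxrankM_maxr.
rewrite -row_free_unit -kermx_eq0; apply/eqP.
set K := kermx _; have KY : K *m Y^T = 0.
  apply: trmx_inj; rewrite trmx0; apply: gram_eq0.
  by rewrite trmxK trmx_mul trmxK !mulmxA -[X in X *m _](mulmxA K) mulmx_ker mul0mx.
have fY : row_free Y^T by rewrite /row_free mxrank_tr rY.
by apply/eqP; rewrite -(mulmx_free_eq0 _ fY) KY.
Qed.

Lemma near_full_rank (U : normedModType R) m k (Y : U -> 'M[R]_(m, k)) a :
  smooth_at Y a -> \rank (Y a) = k -> \forall x \near a, \rank (Y x) = k.
Proof.
move=> sY rY; have sd : smooth_at (fun x => \det ((Y x)^T *m Y x)) a.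
  by apply: smooth_at_det; apply: smooth_at_mulmx => //; exact: smooth_at_trmx.
have nd : \forall d \near \det ((Y a)^T *m Y a), d != 0.
  apply: open_nbhs_nbhs; split; first exact: open_neq.
  by rewrite /= -unitfE -unitmxE gram_unitmx rY.
apply: filterS (near_smooth_at sd nd) => x dx; apply/eqP.
by rewrite -gram_unitmx unitmxE unitfE.
Qed.

Lemma smooth_at_submx (U : normedModType R) m n p q (F : U -> 'M[R]_(m, n))
    (f : 'I_p -> 'I_m) (g : 'I_q -> 'I_n) (G : U -> 'M[R]_(p, q)) a :
  (forall x i j, G x i j = F x (f i) (g j)) -> smooth_at F a -> smooth_at G a.
Proof.
move=> GE sF; apply: smooth_at_mx => i j.
by apply: smooth_at_ext (smooth_at_coord (f i) (g j) sF) => x; rewrite GE.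
Qed.

Lemma smooth_at_block_mx (U : normedModType R) m1 m2 n1 n2 (A : U -> 'M[R]_(m1, n1))
    (B : U -> 'M[R]_(m1, n2)) (C : U -> 'M[R]_(m2, n1)) (D : U -> 'M[R]_(m2, n2)) a :
  smooth_at A a -> smooth_at B a -> smooth_at C a -> smooth_at D a ->
  smooth_at (fun x => block_mx (A x) (B x) (C x) (D x)) a.
Proof.
move=> sA sB sC sD; apply: smooth_at_mx => i j.
by case: (split_ordP i) => i' ->; case: (split_ordP j) => j' ->;
  [apply: smooth_at_ext (smooth_at_coord i' j' sA)
  |apply: smooth_at_ext (smooth_at_coord i' j' sB)
  |apply: smooth_at_ext (smooth_at_coord i' j' sC)
  |apply: smooth_at_ext (smooth_at_coord i' j' sD)] => x;
  rewrite ?block_mxEul ?block_mxEur ?block_mxEdl ?block_mxEdr.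
Qed.

(* Inverse transposed Cholesky factor, by recursion on the Schur complement. *)
Lemma smooth_orthonormalization k : exists G : 'M[R]_k -> 'M[R]_k,
  smooth_at G 1%:M /\
  \forall B \near (1%:M : 'M[R]_k), B^T = B -> (G B)^T *m B *m G B = 1%:M.
Proof.
elim: k => [|k [G [sG GE]]].
  exists id; split; first exact: smooth_at_id.
  by near=> B; move=> _; apply/matrixP => -[].
rewrite -[k.+1]/(1 + k)%N.
pose a (B : 'M[R]_(1 + k)) : R := B (lshift k 0) (lshift k 0).
pose Sc (B : 'M[R]_(1 + k)) := drsubmx B + (- (a B)^-1) *: (dlsubmx B *m ursubmx B).
have sa B : smooth_at a B by exact: smooth_at_coord (smooth_at_id B).
have a1 : a 1%:M = 1 by rewrite /a mxE eqxx.
have sV : smooth_at (fun B => - (a B)^-1) (1%:M : 'M[R]_(1 + k)).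
  apply: (@smooth_at_ext _ _ _ (fun B => -1 * (a B)^-1)) => [x|]; first by rewrite mulN1r.
  apply: smooth_atM; first exact: smooth_at_cst.
  by apply: smooth_atV; rewrite ?a1 ?oner_eq0//.
have sur B : smooth_at (fun B : 'M[R]_(1 + k) => ursubmx B) B.
  by apply: smooth_at_submx (smooth_at_id B) => x i j; rewrite !mxE; reflexivity.
have sdl B : smooth_at (fun B : 'M[R]_(1 + k) => dlsubmx B) B.
  by apply: smooth_at_submx (smooth_at_id B) => x i j; rewrite !mxE; reflexivity.
have sdr B : smooth_at (fun B : 'M[R]_(1 + k) => drsubmx B) B.
  by apply: smooth_at_submx (smooth_at_id B) => x i j; rewrite !mxE; reflexivity.
have sSc : smooth_at Sc 1%:M.
  by apply: smooth_atD => //; apply: smooth_at_scalemx => //; exact: smooth_at_mulmx.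
have Sc1 : Sc 1%:M = 1%:M.
  rewrite /Sc scalar_mx_block block_mxKdr block_mxKdl block_mxKur.
  by rewrite mul0mx scaler0 addr0.
have sGS : smooth_at (fun B => G (Sc B)) 1%:M.
  by apply: smooth_at_comp sSc _; rewrite Sc1.
(* For B with corner a, row u and lower block C, the entry -u H / a clears the off-diagonal blocks
   and leaves the Schur complement C - u^T u / a to H; the factor 1 / sqrt a normalizes the
   corner. *)
exists (fun B => block_mx ((Num.sqrt (a B))^-1%:M)
  ((- (a B)^-1) *: (ursubmx B *m G (Sc B))) 0 (G (Sc B))); split.
  apply: smooth_at_block_mx => //; last exact: smooth_at_cst.
    apply: (@smooth_at_ext _ _ _ (fun B => (Num.sqrt (a B))^-1 *: 1%:M)).
      by move=> B; rewrite scalemx1.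
    apply: smooth_at_scalemx; last exact: smooth_at_cst.
    apply: smooth_atV; last by rewrite a1 sqrtr1 oner_eq0.
    by apply: smooth_at_sqrt => //; rewrite a1.
  by apply: smooth_at_scalemx => //; exact: smooth_at_mulmx.
have apos : \forall B \near (1%:M : 'M[R]_(1 + k)), 0 < a B.
  have /(_ [set x : R | 0 < x]) := smooth_at_continuous (sa 1%:M); apply.
  by apply: open_nbhs_nbhs; split; [exact: open_gt|rewrite /= a1].
have GSE : \forall B \near (1%:M : 'M[R]_(1 + k)), (Sc B)^T = Sc B ->
    (G (Sc B))^T *m Sc B *m G (Sc B) = 1%:M.
  have /(_ [set C | C^T = C -> (G C)^T *m C *m G C = 1%:M]) := smooth_at_continuous sSc.
  by apply; rewrite Sc1.
apply: filterS2 apos GSE => B aB GS Bt.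
have dlE : dlsubmx B = (ursubmx B)^T by rewrite trmx_ursub Bt.
have Sct : (Sc B)^T = Sc B.
  by rewrite /Sc linearD linearZ /= dlE trmx_mul trmxK trmx_drsub Bt.
have {}GS := GS Sct; move: GS; rewrite {2}/Sc.
set H := G (Sc B) => HE.
have BE : B = block_mx (a B)%:M (ursubmx B) (ursubmx B)^T (drsubmx B).
  rewrite -{1}[B]submxK dlE; congr block_mx; rewrite [LHS]mx11_scalar; congr _%:M.
  by rewrite !mxE.
have a0 : a B != 0 by rewrite gt_eqF.
have s0 : Num.sqrt (a B) != 0 by rewrite gt_eqF// sqrtr_gt0.
set s := Num.sqrt (a B) in s0 *; have ss : s * s = a B by rewrite -expr2 sqr_sqrtr// ltW.
rewrite [X in _ *m X *m _]BE tr_block_mx !mulmx_block.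
rewrite !tr_scalar_mx !trmx0 !mul0mx !mulmx0 !addr0 -!scalar_mxM.
have dl0 : (- (a B)^-1 *: (ursubmx B *m H))^T *m (a B)%:M + H^T *m (ursubmx B)^T = 0.
  rewrite linearZ /= trmx_mul mul_mx_scalar scalerA mulrN mulfV// scaleN1r.
  by rewrite addNr.
rewrite dl0 !mul0mx add0r [RHS]scalar_mx_block; congr block_mx.
- by congr _%:M; rewrite -ss mulrA mulVf// mul1r mulfV.
- rewrite !mul_scalar_mx -scalemxAl scalerA mulrN mulfK// scaleNr addNr//.
(* The last block is the Schur complement compressed by H, which is the identity by recursion. *)
rewrite -HE mulmxDr mulmxDl [RHS]mulmxDl addrC; congr (_ + _).
rewrite linearZ /= trmx_mul -!(scalemxAl, scalemxAr) dlE; congr (_ *: _).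
by rewrite !mulmxA.
Unshelve. all: by end_near. Qed.

End MatrixFacts.

(** * Curves and tangent spaces *)

Section Curves.
Context {R : realType}.
Implicit Types V W : normedModType R.

Lemma curve_throughP V (A : set V) x v c : curve_through A x v c <->
  [/\ smooth_at c (0 : R), \forall t \near (0 : R), A (c t), c 0 = x
    & is_derive (0 : R) (1 : R) c v].
Proof. by []. Qed.

Lemma smooth_at_line V (x v : V) t : smooth_at (fun s : R => x + s *: v) t.
Proof.
apply: smooth_atD; first exact: smooth_at_cst.
have [l [cl lE]] := linear_scalel v.
by apply: smooth_at_ext (smooth_at_linear cl (smooth_at_id t)) => s; rewrite lE.
Qed.

Lemma is_derive_line V (x v : V) t : is_derive t (1 : R) (fun s : R => x + s *: v) v.
Proof.
have [l [cl lE]] := linear_scalel v.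
have := is_deriveD (is_derive_cst x t (1 : R)) (is_derive_linear cl (is_derive_id t (1 : R))).
rewrite lE scale1r add0r; congr is_derive; apply/funext => s.
by rewrite fctE lE.
Qed.

Lemma curve_through_line V (A : set V) x v :
  (\forall t \near (0 : R), A (x + t *: v)) ->
  curve_through A x v (fun t => x + t *: v).
Proof.
move=> Av; apply/curve_throughP; split=> //.
- exact: smooth_at_line.
- by rewrite scale0r addr0.
- exact: is_derive_line.
Qed.

Lemma curve_through_continuous V (A : set V) x v c :
  curve_through A x v c -> {for 0 : R, continuous c}.
Proof.
by move=> /curve_throughP[sc _ _ _]; exact: smooth_at_continuous.
Qed.

Lemma near_curve V (A : set V) x v c (P : set V) :
  curve_through A x v c -> (\forall y \near x, P y) -> \forall t \near (0 : R), P (c t).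
Proof.
move=> cc; have := curve_through_continuous cc.
by move/curve_throughP: cc => [_ _ c0 _] h Px; apply: (h P); rewrite c0.
Qed.

Lemma curve_through_image V W `{!findim V} `{!findim W}
    (A : set V) (B : set W) x v c (F : V -> W) :
  curve_through A x v c -> smooth_at F x ->
  (\forall y \near x, A y -> B (F y)) ->
  curve_through B (F x) ('D_v F x) (fun t => F (c t)).
Proof.
move=> cc sF AB; have ncAB := near_curve cc AB.
move/curve_throughP: cc => [sc Ac c0 dc]; apply/curve_throughP; split.
- by apply: smooth_at_comp => //; rewrite c0.
- by apply: filterS2 Ac ncAB => t ? ; apply.
- by rewrite c0.
- have dF : differentiable F (c 0) by rewrite c0; exact: smooth_at_differentiable.
  by have := is_derive_curve dc dF; rewrite c0.
Qed.

(** The rescaled curve is the image under c of the straight line t -> a t in R. *)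
Lemma curve_through_scale V `{!findim V} (A : set V) x v c a :
  curve_through A x v c -> curve_through A x (a *: v) (fun t => c (a * t)).
Proof.
move=> /curve_throughP[sc Ac c0 dc].
have aE : (fun t : R => a * t) = (fun t : R => 0 + t *: (a : R)).
  by apply/funext => t; rewrite add0r mulrC.
have a0 : a * 0 = 0 :> R by rewrite mulr0.
have ca : curve_through (A \o c) (0 : R) (a : R) (fun t => a * t).
  rewrite aE; apply: curve_through_line.
  have nA : \forall t \near (0 : R), A (c (a * t)); last first.
    by apply: filterS nA => t; rewrite add0r [t *: _]mulrC.
  have : {for 0 : R, continuous (fun t : R => a * t)}.
    by apply: smooth_at_continuous; rewrite aE; exact: smooth_at_line.
  by move=> h; apply: (h (A \o c)); rewrite a0.
have -> : a *: v = 'D_(a : R) c 0.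
  have dc0 := smooth_at_differentiable sc.
  rewrite deriveE// [X in 'd _ _ X](_ : _ = a *: (1 : R)); last by rewrite /GRing.scale /= mulr1.
  by rewrite linearZ /= -deriveE//; case: dc => _ ->.
by rewrite -c0; apply: curve_through_image ca _ _ => //; near=> y.
Unshelve. all: by end_near. Qed.

(** Lets rays t -> t v serve as curves inside tangent sets before these are known to be linear. *)
Lemma tangent_scale V `{!findim V} (A : set V) x v a :
  tangent A x v -> tangent A x (a *: v).
Proof. by move=> [c cc]; exists (fun t => c (a * t)); exact: curve_through_scale. Qed.

Lemma tangent0 V (A : set V) x : A x -> tangent A x 0.
Proof.
move=> Ax; exists (fun t => x + t *: 0); apply: curve_through_line.
by near=> t; rewrite scaler0 addr0.
Unshelve. all: by end_near. Qed.

Lemma tangent_fst V W (A : set (V * W)) (B : set V) q v :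
  (forall p, A p -> B p.1) -> tangent A q v -> tangent B q.1 v.1.
Proof.
move=> AB [c /curve_throughP[sc Ac c0 dc]]; exists (fun t => (c t).1).
apply/curve_throughP; split.
- exact: smooth_at_fst.
- by apply: filterS Ac => t; exact: AB.
- by rewrite c0.
- exact: is_derive_fst.
Qed.

Lemma is_mdiff_unique V W (A : set V) (f : V -> W) x u w w' :
  is_mdiff A f x u w -> is_mdiff A f x u w' -> w = w'.
Proof.
move=> [[c cc] fw] [_ fw']; exact: is_derive_unique (fw c cc) (fw' c cc).
Qed.

Lemma is_mdiff_mdiff V W (A : set V) (f : V -> W) x u w :
  is_mdiff A f x u w -> mdiff A f x u = w.
Proof.
move=> fw; apply: (is_mdiff_unique _ fw).
by apply: (@xgetPex _ 0 (is_mdiff A f x u)); exists w.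
Qed.

(** Curves in A cannot tell f from its extension, so differentials on subsets become ordinary
    directional derivatives. *)
Lemma is_mdiff_extension V W (A : set V) (f F : V -> W) x u :
  tangent A x u -> differentiable F x -> (\forall y \near x, A y -> F y = f y) ->
  is_mdiff A f x u ('D_u F x).
Proof.
move=> Axu dF FE; split=> // c cc; have nFE := near_curve cc FE.
move/curve_throughP: cc => [sc Ac c0 dc].
apply: (@near_eq_is_derive _ _ _ (fun t => F (c t))).
  by apply: filterS2 Ac nFE => t At; exact.
have dF' : differentiable F (c 0) by rewrite c0.
by have := is_derive_curve dc dF'; rewrite c0.
Qed.

End Curves.

(** * Smooth frames and orthogonal projectors of the tangent spaces *)

Section TangentSpace.
Context {R : realType}.

Definition jacobian_mx m n (F : 'cV[R]_n -> 'cV[R]_m) (x : 'cV[R]_n) : 'M[R]_(m, n) :=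
  \matrix_(i, j) 'D_(delta_mx j 0) F x i 0.

Lemma jacobian_mxP m n (F : 'cV[R]_n -> 'cV[R]_m) x v :
  differentiable F x -> 'D_v F x = jacobian_mx F x *m v.
Proof.
move=> dF; rewrite deriveE// [v in LHS]matrix_sum_delta linear_sum.
apply/colP => i; rewrite summxE !mxE; apply: eq_bigr => j _.
by rewrite big_ord1 linearZ /= !mxE mulrC -deriveE.
Qed.

Lemma smooth_at_jacobian m n (F : 'cV[R]_n -> 'cV[R]_m) x :
  smooth_at F x -> smooth_at (jacobian_mx F) x.
Proof.
move=> sF; apply: smooth_at_mx => i j.
have := smooth_at_coord i 0 (smooth_at_derive (delta_mx j 0) sF).
by apply: smooth_at_ext => y; rewrite mxE.
Qed.

Lemma col_mulmx m n p (A : 'M[R]_(m, n)) (B : 'M[R]_(n, p)) j :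
  col j (A *m B) = A *m col j B.
Proof. by rewrite !colE mulmxA. Qed.

(** Each projector fixes the columns of the other, so P Q = Q and Q P = P; transposing one of these
    gives equality. *)
Lemma is_orthproj_unique n (S : set 'cV[R]_n) P Q :
  is_orthproj S P -> is_orthproj S Q -> P = Q.
Proof.
move=> [Pt PP SP] [Qt QQ SQ].
have PQ : Q *m P = P.
  apply/matrixP => i j; have /SQ : S (col j P) by apply/SP; rewrite -col_mulmx PP.
  by rewrite -col_mulmx => /colP/(_ i); rewrite !mxE.
have QP : P *m Q = Q.
  apply/matrixP => i j; have /SP : S (col j Q) by apply/SQ; rewrite -col_mulmx QQ.
  by rewrite -col_mulmx => /colP/(_ i); rewrite !mxE.
by rewrite -[RHS]Qt -QP trmx_mul Qt Pt PQ.
Qed.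

Definition range_proj n d (B : 'M[R]_(n, d)) : 'M[R]_n :=
  B *m invmx (B^T *m B) *m B^T.

Lemma range_proj_tr n d (B : 'M[R]_(n, d)) : (range_proj B)^T = range_proj B.
Proof. by rewrite /range_proj !trmx_mul trmxK trmx_inv trmx_mul trmxK mulmxA. Qed.

Lemma range_projK n d (B : 'M[R]_(n, d)) : \rank B = d -> range_proj B *m B = B.
Proof.
move=> rB; have uB : B^T *m B \in unitmx by rewrite gram_unitmx rB.
by rewrite /range_proj -!mulmxA mulVmx// mulmx1.
Qed.

Lemma range_proj_idem n d (B : 'M[R]_(n, d)) : \rank B = d ->
  range_proj B *m range_proj B = range_proj B.
Proof. by move=> rB; rewrite {2}/range_proj !mulmxA range_projK. Qed.

Lemma smooth_at_range_proj (U : normedModType R) n d (B : U -> 'M[R]_(n, d)) a :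
  smooth_at B a -> \rank (B a) = d -> smooth_at (fun x => range_proj (B x)) a.
Proof.
move=> sB rB; apply: smooth_at_mulmx; last exact: smooth_at_trmx.
apply: smooth_at_mulmx => //; apply: smooth_at_invmx; last by rewrite gram_unitmx rB.
by apply: smooth_at_mulmx => //; exact: smooth_at_trmx.
Qed.

Lemma is_orthproj_range n d (S : set 'cV[R]_n) (B : 'M[R]_(n, d)) :
  \rank B = d -> (forall u, S u <-> exists w, u = B *m w) ->
  is_orthproj S (range_proj B).
Proof.
move=> rB SB; split; [exact: range_proj_tr|exact: range_proj_idem|].
move=> v; split=> [/SB[w ->]|vE]; first by rewrite mulmxA range_projK.
by apply/SB; exists (invmx (B^T *m B) *m B^T *m v); rewrite !mulmxA.
Qed.

Lemma orthprojP n (S : set 'cV[R]_n) P : is_orthproj S P -> orthproj S = P.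
Proof.
move=> SP; apply: (is_orthproj_unique _ SP).
by apply: (@xgetPex _ 0 (is_orthproj S)); exists P.
Qed.

(** The chart inverse [psi] carries the slice R^d x {0} to M, so the tangent space at y is the image
    of the slice under the differential of [psi] at [phi y]. This formula is smooth in y also off
    M. *)
Lemma tangent_frame n d (M : set 'cV[R]_n) x : embedded_submanifold d M -> M x ->
  exists B : 'cV[R]_n -> 'M[R]_(n, d), smooth_at B x /\
    \forall y \near x, M y ->
      \rank (B y) = d /\ forall u, tangent M y u <-> exists w, u = B y *m w.
Proof.
move=> [dn hM] Mx.
have [B0 [W [phi [psi [Ox [sphi spsi] phiK psiK MO]]]]] := hM x Mx.
(* The inclusion of R^d as the slice of R^n. *)
pose E : 'M[R]_(n, d) := \matrix_(i, j) (i == j :> nat)%:R.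
have ETE : E^T *m E = 1%:M.
  apply/matrixP => i j; rewrite !mxE (bigD1 (widen_ord dn i))//= !mxE eqxx mul1r.
  rewrite big1 ?addr0 // => l li; rewrite !mxE.
  by rewrite [(l == i :> nat)](negbTE li) mul0r.
have EW (w : 'cV[R]_d) (i : 'I_n) : (d <= i)%N -> (E *m w) i 0 = 0.
  move=> di; rewrite mxE big1// => j _; rewrite mxE.
  by rewrite gtn_eqF ?mul0r// (leq_trans (ltn_ord j)).
have EET (v : 'cV[R]_n) : (forall i : 'I_n, (d <= i)%N -> v i 0 = 0) -> E *m (E^T *m v) = v.
  move=> v0; apply/colP => i; case: (leqP d i) => di; first by rewrite EW// v0.
  rewrite mxE (bigD1 (Ordinal di))//= !mxE eqxx mul1r (bigD1 i)//= !mxE eqxx mul1r.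
  rewrite !big1 ?addr0// => j ji.
    by rewrite !mxE [(i == j :> nat)](_ : _ = false) ?mul0r//; apply/negbTE; rewrite eq_sym.
  by rewrite !mxE [(j == i :> nat)](negbTE ji) mul0r.
have sphi_at y : B0 y -> smooth_at phi y by move=> Oy; exists B0.
have spsi_at y : B0 y -> smooth_at psi (phi y) by move=> /phiK[Wy _]; exists W.
have dphi y : B0 y -> differentiable phi y by move=> /sphi_at/smooth_at_differentiable.
have dpsi y : B0 y -> differentiable psi (phi y) by move=> /spsi_at/smooth_at_differentiable.
exists (fun y => jacobian_mx psi (phi y) *m E); split.
  apply: smooth_at_mulmx; last exact: smooth_at_cst.
  by apply: smooth_at_comp (sphi_at _ Ox) _; apply: smooth_at_jacobian; exact: spsi_at.
have nB0 y : B0 y -> \forall z \near y, B0 z.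
  by move=> Oy; exact: (open_nbhs_nbhs (conj sphi.1 Oy)).
have nW y : B0 y -> \forall z \near phi y, W z.
  by move=> /phiK[Wy _]; exact: (open_nbhs_nbhs (conj spsi.1 Wy)).
apply: filterS (nB0 x Ox) => y Oy My.
(* Differentiating [phi] o [psi] = id gives the frame a left inverse, hence rank d. *)
have JJ : jacobian_mx phi y *m jacobian_mx psi (phi y) = 1%:M.
  have JJv (v : 'cV[R]_n) : jacobian_mx phi y *m (jacobian_mx psi (phi y) *m v) = v.
    have dphi' : differentiable phi (psi (phi y)) by rewrite (phiK y Oy).2; exact: dphi.
    have -> : jacobian_mx psi (phi y) *m v = 'd psi (phi y) v.
      by rewrite -jacobian_mxP ?deriveE//; exact: dpsi.
    have -> w : jacobian_mx phi y *m w = 'd phi (psi (phi y)) w.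
      by rewrite (phiK y Oy).2 -deriveE -?jacobian_mxP//; exact: dphi.
    have := diff_comp (dpsi y Oy) dphi' => /(congr1 (fun f => f v)) /= <-.
    rewrite -deriveE; last by apply: differentiable_comp => //; exact: dpsi.
    rewrite (@near_eq_derive _ _ _ _ id) ?derive_id//.
    by apply: filterS (nW y Oy) => z /psiK[].
  apply/matrixP => i j; have := JJv (delta_mx j 0).
  by rewrite mulmxA -colE => /colP/(_ i); rewrite !mxE andbT.
pose Z := [set z : 'cV[R]_n | forall i : 'I_n, (d <= i)%N -> z i 0 = 0].
split.
  have : E^T *m (jacobian_mx phi y *m (jacobian_mx psi (phi y) *m E)) = 1%:M.
    by rewrite (mulmxA (jacobian_mx phi y)) JJ mul1mx.
  rewrite mulmxA => CB; apply/eqP; rewrite eqn_leq rank_leq_col /=.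
  by rewrite -{1}(mxrank1 R d) -CB mxrankM_maxr.
(* The last n - d coordinates of [phi] vanish along a curve in M, hence so do those of the image
   velocity, which then lies in the range of E. *)
move=> u; split=> [[c cc]|[w ->]].
  exists (E^T *m 'D_u phi y); rewrite -mulmxA EET.
    have ppy : 'D_u (psi \o phi) y = u.
      by rewrite (@near_eq_derive _ _ _ _ id) ?derive_id//; apply: filterS (nB0 y Oy) => z /phiK[].
    rewrite -jacobian_mxP; last exact: dpsi.
    rewrite -{1}ppy deriveE; last by apply: differentiable_comp; [exact: dphi|exact: dpsi].
    rewrite diff_comp /=; [|exact: dphi|exact: dpsi].
    by rewrite -deriveE; [rewrite -deriveE//; exact: dphi|exact: dpsi].
  have MZ : \forall z \near y, M z -> Z (phi z).
    by apply: filterS (nB0 y Oy) => z Oz; exact: (MO z Oz).1.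
  have /curve_throughP[_ nc _ /is_derive_mxP dc] :=
    @curve_through_image _ _ _ (findim_matrix _ _) (findim_matrix _ _) _ _ _ _ _ _ cc
      (sphi_at _ Oy) MZ.
  move=> i di; apply: (is_derive_unique (dc i 0)).
  apply: (@near_eq_is_derive _ _ R (cst (0 : R))).
  by apply: filterS nc => t /(_ i di).
rewrite -mulmxA -jacobian_mxP; last exact: dpsi.
(* Conversely, a line in the slice stays there, and [psi] sends it to a curve in M. *)
have Zc : curve_through Z (phi y) (E *m w) (fun t => phi y + t *: (E *m w)).
  apply: curve_through_line; near=> t => i di.
  by rewrite mxE ((MO y Oy).1 My i di) mxE EW// mulr0 addr0.
have ZM : \forall z \near phi y, Z z -> M (psi z).
  apply: filterS (nW y Oy) => z Wz Zz; have [Oz zK] := psiK z Wz.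
  by apply/(MO _ Oz); rewrite zK.
have := @curve_through_image _ _ _ (findim_matrix _ _) (findim_matrix _ _) _ _ _ _ _ _ Zc
  (spsi_at y Oy) ZM.
rewrite (phiK y Oy).2 => cM.
by exists (fun t => psi (phi y + t *: (E *m w))); exact: cM.
Unshelve. all: by end_near. Qed.

Lemma tangent_proj_extension n d (M : set 'cV[R]_n) x : embedded_submanifold d M -> M x ->
  exists F : 'cV[R]_n -> 'M[R]_n, smooth_at F x /\
    \forall y \near x, M y -> is_orthproj (tangent M y) (F y).
Proof.
move=> hM Mx; have [B [sB BE]] := tangent_frame hM Mx.
exists (fun y => range_proj (B y)); split.
  by have [rB _] := nbhs_singleton BE Mx; exact: smooth_at_range_proj.
by apply: filterS BE => y By /By[rB SB]; exact: is_orthproj_range.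
Qed.

Lemma tangent_projP n d (M : set 'cV[R]_n) x : embedded_submanifold d M -> M x ->
  is_orthproj (tangent M x) (tangent_proj M x).
Proof.
move=> hM Mx; have [F [_ /nbhs_singleton/(_ Mx) FE]] := tangent_proj_extension hM Mx.
by rewrite /tangent_proj (orthprojP FE).
Qed.

Lemma tangent_proj_smooth n d (M : set 'cV[R]_n) x : embedded_submanifold d M -> M x ->
  exists F : 'cV[R]_n -> 'M[R]_n, smooth_at F x /\ \forall y \near x, M y -> F y = tangent_proj M y.
Proof.
move=> hM Mx; have [F [sF FE]] := tangent_proj_extension hM Mx.
exists F; split=> //; apply: filterS FE => y FE My.
by rewrite /tangent_proj (orthprojP (FE My)).
Qed.

End TangentSpace.

(** * Projectors and orthonormal frames *)

Section Frames.
Context {R : realType}.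

Lemma invmx_uniq k (A B : 'M[R]_k) : A *m B = 1%:M -> invmx A = B.
Proof.
by move=> AB; have [uA _] := mulmx1_unit AB; rewrite -[LHS]mulmx1 -AB mulKmx.
Qed.

(** With S symmetric and S S = Y^T Y, the two products are S^-1 S S S^-1 and Y S^-1 S^-1 Y^T. *)
Lemma invsqrt_gram n k (Y : 'M[R]_(n, k)) (W := Y *m invsqrtmx (Y^T *m Y)) :
  \rank Y = k -> W^T *m W = 1%:M /\ W *m W^T = range_proj Y.
Proof.
move=> rY; have uA : Y^T *m Y \in unitmx by rewrite gram_unitmx rY.
have [St _ SS] := is_sqrtmx_gram Y.
rewrite /W /invsqrtmx; set S := xget _ _ in St SS *.
have uS : S \in unitmx by move: uA; rewrite -SS unitmx_mul => /andP[].
have it : (invmx S)^T = invmx S by rewrite trmx_inv St.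
split; rewrite trmx_mul it.
  by rewrite !mulmxA -(mulmxA _ Y^T) -SS mulmxA mulVmx// mul1mx mulmxV.
rewrite /range_proj !mulmxA -(mulmxA Y); congr (_ *m _ *m _).
by apply/esym/invmx_uniq; rewrite -SS !mulmxA mulmxK// mulmxV.
Qed.

Lemma rank_stiefel n k (V : 'M[R]_(n, k)) : V^T *m V = 1%:M -> \rank V = k.
Proof. by move=> VV; apply/eqP; rewrite -gram_unitmx VV unitmx1. Qed.

Lemma range_proj_stiefel n k (V : 'M[R]_(n, k)) : V^T *m V = 1%:M ->
  range_proj V = V *m V^T.
Proof. by move=> VV; rewrite /range_proj VV invmx1 mulmx1. Qed.

Lemma rank_mulmx_unit n k (Y : 'M[R]_(n, k)) (Q : 'M[R]_k) :
  Q \in unitmx -> \rank (Y *m Q) = \rank Y.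
Proof. by move=> uQ; rewrite mxrankMfree// row_free_unit. Qed.

(** The two column spaces coincide: each projector fixes the columns of the other, and symmetry
    turns this into equality. *)
Lemma range_projMr n k (Y : 'M[R]_(n, k)) (Q : 'M[R]_k) :
  \rank Y = k -> Q \in unitmx -> range_proj (Y *m Q) = range_proj Y.
Proof.
move=> rY uQ; have rYQ : \rank (Y *m Q) = k by rewrite rank_mulmx_unit.
have P12 : range_proj Y *m range_proj (Y *m Q) = range_proj (Y *m Q).
  by rewrite {2 3}/range_proj !mulmxA range_projK.
have P2Y : range_proj (Y *m Q) *m Y = Y.
  by rewrite -{2}(mulmxK uQ Y) mulmxA range_projK// mulmxK.
have P21 : range_proj (Y *m Q) *m range_proj Y = range_proj Y.
  by rewrite {2 3}/range_proj !mulmxA P2Y.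
by rewrite -range_proj_tr -P12 trmx_mul !range_proj_tr.
Qed.

Lemma rank_range_proj n k (Y : 'M[R]_(n, k)) : \rank Y = k -> \rank (range_proj Y) = k.
Proof.
move=> rY; apply/eqP; rewrite eqn_leq; apply/andP; split.
  by rewrite /range_proj; apply: leq_trans (mxrankM_maxr _ _) _; rewrite mxrank_tr rY.
by rewrite -[X in (X <= _)%N]rY -{1}(range_projK rY) mxrankM_maxl.
Qed.

(** Compressing the hypothesis by V gives X = X + X for X = V^T D V: a tangent vector of the
    Grassmannian has no diagonal block on the range of P. *)
Lemma stiefel_diag_block n k (V : 'M[R]_(n, k)) (D : 'M[R]_n) : V^T *m V = 1%:M ->
  D *m (V *m V^T) + V *m V^T *m D = D -> V^T *m D *m V = 0.
Proof.
move=> VV DE; have : V^T *m D *m V = V^T *m D *m V + V^T *m D *m V.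
  rewrite -{1}DE mulmxDr mulmxDl !mulmxA VV mul1mx; congr (_ + _).
  by rewrite -!mulmxA VV mulmx1.
by move/eqP; rewrite -subr_eq0 opprD addrA subrr sub0r oppr_eq0 => /eqP.
Qed.

Section Subspace.
Variables (n k : nat) (S : set 'cV[R]_n) (Pi : 'M[R]_n).
Hypothesis SPi : is_orthproj S Pi.

Lemma orthproj_colP p (Z : 'M[R]_(n, p)) : (forall j, S (col j Z)) <-> Pi *m Z = Z.
Proof.
have [_ _ SP] := SPi; split=> [SZ|ZE j]; last by apply/SP; rewrite -col_mulmx ZE.
apply/matrixP => i j; have /SP := SZ j.
by rewrite -col_mulmx => /colP/(_ i); rewrite !mxE.
Qed.

Lemma orthproj_vecP p (Z : 'M[R]_(n, p)) : (forall v, S (Z *m v)) <-> Pi *m Z = Z.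
Proof.
have [_ _ SP] := SPi; split=> [SZ|ZE v]; last by apply/SP; rewrite mulmxA ZE.
by apply/orthproj_colP => j; rewrite colE.
Qed.

Lemma GrassmannP (P : 'M[R]_n) : Grassmann k S P <->
  [/\ P^T = P, P *m P = P, Pi *m P = P & \rank P = k].
Proof.
by split=> -[Pt PP /orthproj_vecP SP rP].
Qed.

Lemma StiefelP (V : 'M[R]_(n, k)) : Stiefel k S V <-> V^T *m V = 1%:M /\ Pi *m V = V.
Proof. by split=> -[VV /orthproj_colP SV]. Qed.

Lemma Grassmann_range_proj (Y : 'M[R]_(n, k)) :
  \rank Y = k -> Pi *m Y = Y -> Grassmann k S (range_proj Y).
Proof.
move=> rY YE; apply/GrassmannP; split; [exact: range_proj_tr|exact: range_proj_idem| |].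
- by rewrite /range_proj !mulmxA YE.
- exact: rank_range_proj.
Qed.

Lemma Grassmann_stiefel (V : 'M[R]_(n, k)) : Stiefel k S V -> Grassmann k S (V *m V^T).
Proof.
move=> /StiefelP[VV SV]; rewrite -range_proj_stiefel//.
by apply: Grassmann_range_proj => //; exact: rank_stiefel.
Qed.

Lemma Grassmann_frame (P : 'M[R]_n) : Grassmann k S P ->
  exists V : 'M[R]_(n, k), Stiefel k S V /\ P = V *m V^T.
Proof.
move=> /GrassmannP[Pt PP SP rP].
have [B [rB BE PB]] : exists B : 'M[R]_(n, k),
    [/\ \rank B = k, Pi *m B = B & P = range_proj B].
  (* A rank factorization supplies a basis of the range of P, orthonormalized below. Destructing
     [rP] makes k the rank of P, which is the number of columns of [col_base P]. *)
  case: k / rP; exists (col_base P).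
  have PE : P = col_base P *m row_base P by rewrite mulmx_base.
  have PB : P *m col_base P = col_base P.
    apply: (row_free_inj (row_base_free P)).
    by rewrite -mulmxA mulmx_base.
  have rB : \rank (col_base P) = \rank P by apply/eqP; exact: col_base_full.
  split=> //; first by rewrite -PB mulmxA SP.
  have PQ : P *m range_proj (col_base P) = range_proj (col_base P).
    by rewrite /range_proj 2!mulmxA PB.
  have QP : range_proj (col_base P) *m P = P.
    transitivity (range_proj (col_base P) *m (col_base P *m row_base P)).
      by congr (_ *m _).
    by rewrite mulmxA range_projK.
  by rewrite -[RHS]range_proj_tr -PQ trmx_mul range_proj_tr Pt QP.
have [VV VE] := invsqrt_gram rB.
exists (B *m invsqrtmx (B^T *m B)); split; last by rewrite VE.
by apply/StiefelP; split=> //; rewrite mulmxA BE.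
Qed.

Lemma stiefel_change (V V' : 'M[R]_(n, k)) :
  V^T *m V = 1%:M -> V'^T *m V' = 1%:M -> V *m V^T = V' *m V'^T ->
  exists2 Q, orthogonal_group Q & V' = V *m Q.
Proof.
move=> VV VV' VE; exists (V^T *m V').
  rewrite /orthogonal_group /= trmx_mul trmxK !mulmxA -(mulmxA _ V) VE.
  by rewrite !mulmxA VV' mul1mx.
by rewrite mulmxA VE -mulmxA VV' mulmx1.
Qed.

(* A map that is only linear on S becomes linear after projecting to S. *)
Lemma linear_on_matrix m (f : 'cV[R]_n -> 'cV[R]_m) :
  (forall a v w, S v -> S w -> f (a *: v + w) = a *: f v + f w) ->
  exists L : 'M[R]_(m, n), forall v, S v -> f v = L *m v.
Proof.
move=> lf; have [_ PP SP] := SPi.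
have lg : linear (fun v => f (Pi *m v)).
  by move=> a v w; rewrite mulmxDr -scalemxAr lf//; apply/SP; rewrite mulmxA PP.
pose gM := GRing.isLinear.Build _ _ _ _ _ lg.
pose g : {linear _ -> _} := HB.pack (fun v => f (Pi *m v)) gM.
exists (\matrix_(i, j) g (delta_mx j 0) i 0) => v /SP Sv.
rewrite -{1}Sv -[LHS]/(g v) {1}[v]matrix_sum_delta linear_sum.
apply/colP => i; rewrite summxE !mxE; apply: eq_bigr => j _.
by rewrite big_ord1 linearZ /= !mxE mulrC.
Qed.

End Subspace.

Lemma orthogonal_group_unit k (Q : 'M[R]_k) : orthogonal_group Q -> Q \in unitmx.
Proof. by move=> QQ; have [] := mulmx1_unit QQ. Qed.

Lemma columnwise_matrix m k (f : 'cV[R]_m -> 'cV[R]_m) (L : 'M[R]_m) (Z : 'M[R]_(m, k)) :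
  (forall j, f (col j Z) = L *m col j Z) -> columnwise f Z = L *m Z.
Proof.
move=> fL; apply/matrixP => i j; rewrite mxE fL -col_mulmx !mxE.
by apply: eq_bigr => l _.
Qed.

Lemma is_derive_sym n (P : R -> 'M[R]_n) t D : is_derive t (1 : R) P D ->
  (\forall s \near t, (P s)^T = P s) -> D^T = D.
Proof.
move=> dP Pt; apply: (is_derive_unique (is_derive_trmx dP)).
by apply: near_eq_is_derive dP; apply: filterS Pt => s ->.
Qed.

Lemma is_derive_proj n (P : R -> 'M[R]_n) t D : is_derive t (1 : R) P D ->
  (\forall s \near t, P s *m P s = P s) -> D *m P t + P t *m D = D.
Proof.
move=> dP Pt; apply: (is_derive_unique (is_derive_mulmx dP dP)).
by apply: near_eq_is_derive dP; apply: filterS Pt => s ->.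
Qed.

(* With V^T Y' antisymmetric the Gram matrix is stationary, so its inverse does
   not contribute to the derivative. *)
Lemma is_derive_range_proj n k (Y : R -> 'M[R]_(n, k)) V dY :
  smooth_at Y (0 : R) -> Y 0 = V -> V^T *m V = 1%:M ->
  is_derive (0 : R) (1 : R) Y dY -> V^T *m dY + dY^T *m V = 0 ->
  is_derive (0 : R) (1 : R) (fun t => range_proj (Y t)) (dY *m V^T + V *m dY^T).
Proof.
move=> sY Y0 VV dYt skew.
pose A t := (Y t)^T *m Y t.
have A0 : A 0 = 1%:M by rewrite /A Y0.
have dA : is_derive (0 : R) (1 : R) A 0.
  have := is_derive_mulmx (is_derive_trmx dYt) dYt; rewrite Y0.
  by rewrite addrC skew.
have sA : smooth_at A 0 by apply: smooth_at_mulmx => //; exact: smooth_at_trmx.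
have uA : A 0 \in unitmx by rewrite A0 unitmx1.
have /smooth_at_differentiable/derivable1_diffP/derivableP dI := smooth_at_invmx sA uA.
have near_uA : \forall t \near (0 : R), A t \in unitmx.
  have rY : \rank (Y 0) = k by rewrite Y0; exact: rank_stiefel.
  by apply: filterS (near_full_rank sY rY) => t rYt; rewrite gram_unitmx rYt.
(* Differentiate A A^-1 = 1, using A' = 0 and A = 1 at time 0. *)
have dI0 : 'D_1 (fun t => invmx (A t)) 0 = 0.
  have dAI := is_derive_mulmx dA dI.
  have := is_derive_unique dAI; rewrite A0 invmx1 mul0mx add0r mul1mx; apply.
  apply: (@near_eq_is_derive _ _ _ (cst 1%:M)).
  by apply: filterS near_uA => t uAt; rewrite mulmxV.
rewrite dI0 in dI.
have := is_derive_mulmx (is_derive_mulmx dYt dI) (is_derive_trmx dYt).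
by rewrite A0 Y0 invmx1 !mulmx1 mulmx0 addr0.
Qed.

End Frames.

(** * Tangent vectors of the Grassmann bundle *)

Section GrassmannBundle.
Context {R : realType} {n d k : nat} {M : set 'cV[R]_n}.
Hypothesis hM : embedded_submanifold d M.

Let PiP x (Mx : M x) : is_orthproj (tangent M x) (tangent_proj M x) := tangent_projP hM Mx.

Lemma is_mdiff_tangent_proj x u : M x -> tangent M x u ->
  exists2 D, is_mdiff M (tangent_proj M) x u D & mdiff M (tangent_proj M) x u = D.
Proof.
move=> Mx Tu; have [F [sF FE]] := tangent_proj_smooth hM Mx.
have := is_mdiff_extension Tu (smooth_at_differentiable sF) FE => DF.
by exists ('D_u F x) => //; exact: is_mdiff_mdiff.
Qed.

(** Along a curve (x(t), P(t)) of the bundle, with Pi taken at x(t), these are the derivatives of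
    P^T = P, P P = P, Pi^T = Pi and Pi P = P. *)
Lemma tangent_Gr_bundleP x P u D :
  M x -> tangent (Gr_bundle M k) (x, P) (u, D) ->
  let Pi' := mdiff M (tangent_proj M) x u in
  [/\ tangent M x u, D^T = D, D *m P + P *m D = D, Pi'^T = Pi'
    & Pi' *m P + tangent_proj M x *m D = D].
Proof.
move=> Mx TuD.
have Tu : tangent M x u by have := tangent_fst (B := M) _ TuD; apply => q [].
have [D' [_ DPi] ->] := is_mdiff_tangent_proj Mx Tu.
case: TuD => c /curve_throughP[sc Gc c0 dc] /=.
have dx : is_derive (0 : R) (1 : R) (fun t => (c t).1) u := is_derive_fst dc.
have dP : is_derive (0 : R) (1 : R) (fun t => (c t).2) D := is_derive_snd dc.
have cx : curve_through M x u (fun t => (c t).1).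
  apply/curve_throughP; split=> //; [exact: smooth_at_fst| |by rewrite c0].
  by apply: filterS Gc => t [].
have dPi := DPi _ cx.
have GP : \forall t \near (0 : R),
    [/\ (c t).2^T = (c t).2, (c t).2 *m (c t).2 = (c t).2,
    tangent_proj M (c t).1 *m (c t).2 = (c t).2 &
    (tangent_proj M (c t).1)^T = tangent_proj M (c t).1].
  apply: filterS Gc => t [Mt Gt]; have [Pt PP PG _] := (GrassmannP k (PiP Mt) _).1 Gt.
  by split=> //; case: (PiP Mt).
split=> //.
- by apply: is_derive_sym dP _; apply: filterS GP => t [].
- have := is_derive_proj dP; rewrite c0; apply.
  by apply: filterS GP => t [].
- by apply: is_derive_sym dPi _; apply: filterS GP => t [].
- have := is_derive_mulmx dPi dP; rewrite c0 /= => dPP.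
  apply: (is_derive_unique dPP); apply: near_eq_is_derive dP.
  by apply: filterS GP => t [].
Qed.

(** The witness is the curve of range projectors of V + t D V. Since V^T D V = 0, its Gram matrix is
    stationary and its velocity is D V V^T + V V^T D = D. *)
Lemma tangent_GrI x P D : M x -> Grassmann k (tangent M x) P ->
  D^T = D -> D *m P + P *m D = D -> tangent_proj M x *m D = D ->
  tangent_Gr M k x P D.
Proof.
move=> Mx GP Dt DP PiD.
have [V [StV PV]] := Grassmann_frame (PiP Mx) GP.
have [VV PiV] := (StiefelP (PiP Mx) _).1 StV.
pose Y (t : R) := V + t *: (D *m V).
have sY t : smooth_at Y t by exact: smooth_at_line.
have dY t : is_derive t (1 : R) Y (D *m V) by exact: is_derive_line.
have Y0 : Y 0 = V by rewrite /Y scale0r addr0.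
have VDV : V^T *m (D *m V) = 0.
  by rewrite mulmxA stiefel_diag_block// -PV.
have skew : V^T *m (D *m V) + (D *m V)^T *m V = 0.
  by rewrite trmx_mul Dt -mulmxA VDV addr0.
exists (fun t => range_proj (Y t)); apply/curve_throughP; split.
- by apply: smooth_at_range_proj => //; rewrite Y0; exact: rank_stiefel.
- have nY : \forall t \near (0 : R), \rank (Y t) = k.
    by apply: near_full_rank => //; rewrite Y0; exact: rank_stiefel.
  apply: filterS nY => t rY; apply: (Grassmann_range_proj (PiP Mx)) => //.
  by rewrite /Y mulmxDr -scalemxAr mulmxA PiD PiV.
- by rewrite Y0 range_proj_stiefel.
have := is_derive_range_proj (sY 0) Y0 VV (dY 0) skew.
by rewrite trmx_mul Dt (mulmxA V) -(mulmxA D) -PV DP.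
Qed.

(** Makes Pi D Pi a legitimate argument of [Rhat]: since Pi P = P = P Pi, the identity D P + P D = D
    survives the compression. *)
Lemma vertical_part_tangent x P u D :
  Gr_bundle M k (x, P) -> tangent (Gr_bundle M k) (x, P) (u, D) ->
  vertical_bundle M k (x, P, vertical_part M x D).
Proof.
move=> [/= Mx GP] TuD; split=> //=.
have [Pt PP PiPE _] := (GrassmannP k (PiP Mx) _).1 GP.
have [Pit PiPi _] := PiP Mx.
have PPi : P *m tangent_proj M x = P by rewrite -[LHS]trmxK trmx_mul Pit Pt PiPE Pt.
have [_ Dt DP _ _] := tangent_Gr_bundleP Mx TuD.
apply: tangent_GrI => //.
- by rewrite /vertical_part !trmx_mul Dt Pit mulmxA.
- rewrite /vertical_part -[in RHS]DP mulmxDr mulmxDl !mulmxA PPi PiPE; congr (_ + _).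
  by rewrite -!mulmxA PiPE PPi.
- by rewrite /vertical_part !mulmxA PiPi.
Qed.

End GrassmannBundle.

(** * The retraction *)

(** The range of W lies in that of P and has the same dimension k; the comparison is made on row
    spaces, hence on transposes. *)
Lemma projection_frame (R : realType) n k (P : 'M[R]_n) (W : 'M[R]_(n, k)) :
  P^T = P -> \rank P = k -> W^T *m W = 1%:M -> P *m W = W -> P = W *m W^T.
Proof.
move=> Pt rP WW PW.
have WP : (W^T <= P)%MS by apply/submxP; exists W^T; rewrite -[P]Pt -trmx_mul PW.
have : (P <= W^T)%MS.
  by rewrite -(geq_leqif (mxrank_leqif_sup WP)) rP mxrank_tr rank_stiefel.
move=> /submxP[X XE]; rewrite -{1}PW -mulmxA [in RHS]XE.
by rewrite -[X *m W^T *m _]mulmxA (mulmxA W^T) WW mul1mx.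
Qed.

Lemma rel_open_near (T : topologicalType) (A U : set T) : U `<=` A ->
  (forall a, U a -> \forall y \near a, A y -> U y) -> rel_open A U.
Proof.
move=> UA AU; exists (interior [set y | A y -> U y]); first exact: open_interior.
apply/seteqP; split=> [a Ua|a [Aa /interior_subset]]; last exact.
by split; [exact: UA|exact: AU].
Qed.

Section GrassmannRetraction.
Context {R : realType} {n d k : nat} {M : set 'cV[R]_n}.
Hypothesis hM : embedded_submanifold d M.
Variable RM : 'cV[R]_n -> 'cV[R]_n -> 'cV[R]_n.
Hypothesis hRM : retraction M RM.
Variable Rhat : 'cV[R]_n -> 'M[R]_n -> 'M[R]_(n, k) -> 'M[R]_n -> 'M[R]_(n, k).
Variable D : set ('cV[R]_n * 'M[R]_n * 'M[R]_n).
Hypothesis hRhat : Gr_lift_family M Rhat D.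
Variable VT : 'cV[R]_n -> 'cV[R]_n -> 'cV[R]_n -> 'cV[R]_n.
Hypothesis hVT : vector_transport M RM VT.

Let PiP x (Mx : M x) : is_orthproj (tangent M x) (tangent_proj M x) := tangent_projP hM Mx.

Local Notation Y := (Ymap M VT Rhat).

Lemma Rhat_tangent x P V De : M x -> Stiefel k (tangent M x) V -> P = V *m V^T ->
  D (x, P, De) -> forall j, tangent M x (col j (Rhat x P V De)).
Proof.
move=> Mx StV PV DD j; have [_ _ RP] := hRhat.
have GP : Gr_bundle M k (x, P) by split=> //=; rewrite PV; exact: (Grassmann_stiefel (PiP Mx) StV).
by have [_ /(_ _ DD)[RT _ _ _]] := RP x P V GP StV PV; rewrite colE.
Qed.

(** One matrix L represents [VT x u] on the whole tangent space, so the equivariance of [Rhat] under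
    Q passes through the transport by associativity. *)
Lemma Ymap_matrix x P V u De : M x -> tangent M x u ->
  Stiefel k (tangent M x) V -> P = V *m V^T -> D (x, P, vertical_part M x De) ->
  exists L : 'M[R]_n, forall Q, orthogonal_group Q ->
    Y x P (V *m Q) u De = L *m Zmap M Rhat x P V De *m Q.
Proof.
move=> Mx Tu StV PV DD; have [_ _ VTl _] := hVT.
have [L LE] := linear_on_matrix (PiP Mx) (f := VT x u)
  (fun a v w Sv Sw => VTl x u a v w Mx Tu Sv Sw).
exists L => Q QQ.
have GP : Gr_bundle M k (x, P) by split=> //=; rewrite PV; exact: (Grassmann_stiefel (PiP Mx) StV).
have [_ _ RP] := hRhat.
have [_ /(_ _ DD)[RT _ RQ _]] := RP x P V GP StV PV.
rewrite /Ymap /Zmap RQ// -mulmxA; apply: columnwise_matrix => j; apply: LE.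
by rewrite colE -mulmxA; exact: RT.
Qed.

Lemma orthogonal_group1 : orthogonal_group (1%:M : 'M[R]_k).
Proof. by rewrite /orthogonal_group /= trmx1 mulmx1. Qed.

Lemma Ymap_orth x P V u De Q : M x -> tangent M x u ->
  Stiefel k (tangent M x) V -> P = V *m V^T -> D (x, P, vertical_part M x De) ->
  orthogonal_group Q -> Y x P (V *m Q) u De = Y x P V u De *m Q.
Proof.
move=> Mx Tu StV PV DD QQ; have [L LE] := Ymap_matrix Mx Tu StV PV DD.
by rewrite LE// -[V in RHS]mulmx1 LE ?mulmx1//; exact: orthogonal_group1.
Qed.

Lemma Ymap_tangent x P V u De : M x -> tangent M x u ->
  Stiefel k (tangent M x) V -> P = V *m V^T -> D (x, P, vertical_part M x De) ->
  forall j, tangent M (RM x u) (col j (Y x P V u De)).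
Proof.
move=> Mx Tu StV PV DD j; have [_ VTT _ _] := hVT.
have -> : col j (Y x P V u De) = VT x u (col j (Zmap M Rhat x P V De)).
  by apply/colP => i; rewrite !mxE.
by apply: VTT => //; exact: Rhat_tangent.
Qed.

Lemma tangent_bundle_Gr x P u De : tangent_bundle (Gr_bundle M k) ((x, P), (u, De)) ->
  [/\ M x, Grassmann k (tangent M x) P & tangent M x u].
Proof.
move=> [[/= Mx GP] T]; split=> //.
by have [] := tangent_Gr_bundleP hM Mx T.
Qed.

(** Two frames of P differ by an orthogonal Q, which multiplies Y by an invertible matrix, so full
    rank in one frame is full rank in all. *)
Lemma Gr_domainI x P u De V : tangent_bundle (Gr_bundle M k) ((x, P), (u, De)) ->
  D (x, P, vertical_part M x De) -> Stiefel k (tangent M x) V -> P = V *m V^T ->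
  \rank (Y x P V u De) = k -> Gr_domain M VT Rhat D ((x, P), (u, De)).
Proof.
move=> TB DD StV PV rY; have [Mx GP Tu] := tangent_bundle_Gr TB.
split=> // V' StV' PV'.
have [VV _] := StV; have [VV' _] := StV'.
have [Q QQ ->] := stiefel_change VV VV' (etrans (esym PV) PV').
by rewrite Ymap_orth// rank_mulmx_unit//; exact: orthogonal_group_unit.
Qed.

Lemma Ptilde_range_proj x P V u De : \rank (Y x P V u De) = k ->
  Ptilde M VT Rhat x P V u De = range_proj (Y x P V u De).
Proof. by move=> /invsqrt_gram[]. Qed.

Lemma Ptilde_frame x P u De V V' : Gr_domain M VT Rhat D ((x, P), (u, De)) ->
  Stiefel k (tangent M x) V -> P = V *m V^T ->
  Stiefel k (tangent M x) V' -> P = V' *m V'^T ->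
  Ptilde M VT Rhat x P V u De = Ptilde M VT Rhat x P V' u De.
Proof.
move=> [TB DD rY] StV PV StV' PV'; have [Mx GP Tu] := tangent_bundle_Gr TB.
rewrite !Ptilde_range_proj//; try exact: rY.
have [VV _] := StV; have [VV' _] := StV'.
have [Q QQ ->] := stiefel_change VV VV' (etrans (esym PV) PV').
rewrite Ymap_orth// range_projMr//; first exact: rY.
exact: orthogonal_group_unit.
Qed.

Lemma Vtilde_Stiefel x P u De V : Gr_domain M VT Rhat D ((x, P), (u, De)) ->
  Stiefel k (tangent M x) V -> P = V *m V^T ->
  M (RM x u) /\ Stiefel k (tangent M (RM x u)) (Vtilde M VT Rhat x P V u De).
Proof.
move=> [TB DD rY] StV PV; have [Mx GP Tu] := tangent_bundle_Gr TB.
have [_ RMM _ _ _] := hRM; have MRM : M (RM x u) by exact: RMM.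
split=> //; apply/(StiefelP (PiP MRM) _); split; first by have [] := invsqrt_gram (rY V StV PV).
rewrite /Vtilde mulmxA; congr (_ *m _).
by apply/(orthproj_colP (PiP MRM)); exact: Ymap_tangent.
Qed.

(** An arbitrary choice, with no continuity in (x, P). It only gives the retraction a value;
    smoothness is proved after passing to a smooth local frame, by [Ptilde_frame]. *)
Definition Gr_frame (q : 'cV[R]_n * 'M[R]_n) : 'M[R]_(n, k) :=
  xget 0 [set V | Stiefel k (tangent M q.1) V /\ q.2 = V *m V^T].

Lemma Gr_frameP q : Gr_bundle M k q ->
  Stiefel k (tangent M q.1) (Gr_frame q) /\ q.2 = Gr_frame q *m (Gr_frame q)^T.
Proof.
move=> [Mx GP]; have [V VE] := Grassmann_frame (PiP Mx) GP.
by apply: (@xgetPex _ 0 [set V | Stiefel k (tangent M q.1) V /\ q.2 = V *m V^T]); exists V.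
Qed.

Definition Gr_retraction (q w : 'cV[R]_n * 'M[R]_n) : 'cV[R]_n * 'M[R]_n :=
  (RM q.1 w.1, Ptilde M VT Rhat q.1 q.2 (Gr_frame q) w.1 w.2).

Lemma Gr_retractionE x P u De V : Gr_domain M VT Rhat D ((x, P), (u, De)) ->
  Stiefel k (tangent M x) V -> P = V *m V^T ->
  Gr_retraction (x, P) (u, De) = (RM x u, Ptilde M VT Rhat x P V u De).
Proof.
move=> qD StV PV; congr pair; have [[Gq _] _ _] := qD.
by have [] := Gr_frameP Gq; move=> StF PF; exact: Ptilde_frame.
Qed.

Lemma Gr_retraction_bundle q w : Gr_domain M VT Rhat D (q, w) ->
  Gr_bundle M k (Gr_retraction q w).
Proof.
case: q w => x P [u De] qD; have [[Gq _] _ _] := qD.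
have [StF PF] := Gr_frameP Gq.
rewrite (Gr_retractionE qD StF PF).
have [MRM StV] := Vtilde_Stiefel qD StF PF.
by split=> //=; exact: (Grassmann_stiefel (PiP MRM) StV).
Qed.

(** For a projector P, V0^T P V0 is the Gram matrix of P V0, and it is 1 at P0, near which G is
    available. The frame depends on P alone and S is quantified after the neighbourhood, so one F
    serves all nearby tangent spaces. *)
Lemma smooth_frame (P0 : 'M[R]_n) (V0 : 'M[R]_(n, k)) :
  V0^T *m V0 = 1%:M -> P0 = V0 *m V0^T ->
  exists F : 'M[R]_n -> 'M[R]_(n, k), smooth_at F P0 /\
    \forall P \near P0, forall S : set 'cV[R]_n, (exists Pi, is_orthproj S Pi) ->
      Grassmann k S P -> Stiefel k S (F P) /\ P = F P *m (F P)^T.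
Proof.
move=> VV PV; have [G [sG GE]] := @smooth_orthonormalization R k.
pose B (P : 'M[R]_n) := V0^T *m P *m V0.
have sB : smooth_at B P0.
  apply: smooth_at_mulmx; last exact: smooth_at_cst.
  apply: smooth_at_mulmx; [exact: smooth_at_cst|exact: smooth_at_id].
have B0 : B P0 = 1%:M by rewrite /B PV !mulmxA VV mul1mx.
exists (fun P => P *m V0 *m G (B P)); split.
  apply: smooth_at_mulmx.
    apply: smooth_at_mulmx; [exact: smooth_at_id|exact: smooth_at_cst].
  by apply: smooth_at_comp sB _; rewrite B0.
have : \forall P \near P0, (B P)^T = B P -> (G (B P))^T *m B P *m G (B P) = 1%:M.
  have h := smooth_at_continuous sB.
  by apply: (h [set C | C^T = C -> (G C)^T *m C *m G C = 1%:M]); rewrite B0.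
apply: filterS => P GP S [Pi SPi] /(GrassmannP k SPi)[Pt PP PiP' rP].
have Bt : (B P)^T = B P by rewrite /B !trmx_mul trmxK Pt mulmxA.
have FF : (P *m V0 *m G (B P))^T *m (P *m V0 *m G (B P)) = 1%:M.
  rewrite !trmx_mul Pt -(GP Bt) /B !mulmxA; congr (_ *m _ *m _).
  by rewrite -(mulmxA _ P P) PP.
split; last by apply: projection_frame => //; rewrite !mulmxA PP.
by apply/(StiefelP SPi _); split=> //; rewrite !mulmxA PiP'.
Qed.

(** The frame, the tangent projector, [Rhat] and the transport are each replaced by a smooth
    extension. On the tangent bundle every argument lands where the next extension agrees with the
    original map. *)
Lemma Ymap_extension q0 : tangent_bundle (Gr_bundle M k) q0 ->
  D (q0.1, vertical_part M q0.1.1 q0.2.2) ->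
  exists FV FY : ('cV[R]_n * 'M[R]_n) * ('cV[R]_n * 'M[R]_n) -> 'M[R]_(n, k),
    smooth_at FY q0 /\ \forall q \near q0, tangent_bundle (Gr_bundle M k) q ->
      [/\ D (q.1, vertical_part M q.1.1 q.2.2), Stiefel k (tangent M q.1.1) (FV q),
          q.1.2 = FV q *m (FV q)^T
        & FY q = Y q.1.1 q.1.2 (FV q) q.2.1 q.2.2].
Proof.
set A := ('cV[R]_n * 'M[R]_n * ('cV[R]_n * 'M[R]_n))%type.
case: q0 => -[x0 P0] [u0 De0] TB DD /=; rewrite /= in DD.
set q0 : A := (x0, P0, (u0, De0)).
have [Mx0 GP0 Tu0] := tangent_bundle_Gr TB.
have [V0 [StV0 PV0]] := Grassmann_frame (PiP Mx0) GP0.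
have [F [sF FE]] := smooth_frame StV0.1 PV0.
have sx : smooth_at (fun q : A => q.1.1) q0.
  by apply: smooth_at_fst; apply: smooth_at_fst; exact: smooth_at_id.
have sP : smooth_at (fun q : A => q.1.2) q0.
  by apply: smooth_at_snd; apply: smooth_at_fst; exact: smooth_at_id.
have su : smooth_at (fun q : A => q.2.1) q0.
  by apply: smooth_at_fst; apply: smooth_at_snd; exact: smooth_at_id.
have sDe : smooth_at (fun q : A => q.2.2) q0.
  by apply: smooth_at_snd; apply: smooth_at_snd; exact: smooth_at_id.
pose FV (q : A) := F q.1.2.
have sFV : smooth_at FV q0 by apply: smooth_at_comp sP _.
have FVE : \forall q \near q0, tangent_bundle (Gr_bundle M k) q ->
    Stiefel k (tangent M q.1.1) (FV q) /\ q.1.2 = FV q *m (FV q)^T.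
  have {}FE := near_smooth_at sP FE.
  apply: filterS FE => -[[x P] [u De]] /= FE /tangent_bundle_Gr[Mx GP Tu].
  exact: (FE (tangent M x) (ex_intro _ _ (PiP Mx)) GP).
have [FPi [sFPi FPiE]] := tangent_proj_smooth hM Mx0.
pose FDe (q : A) := FPi q.1.1 *m q.2.2 *m FPi q.1.1.
have sFPix : smooth_at (fun q : A => FPi q.1.1) q0 by apply: smooth_at_comp sx _.
have sFDe : smooth_at FDe q0.
  by apply: smooth_at_mulmx => //; exact: smooth_at_mulmx.
have FDeE : \forall q \near q0, M q.1.1 -> FDe q = vertical_part M q.1.1 q.2.2.
  have {}FPiE := near_smooth_at sx FPiE.
  by apply: filterS FPiE => q FPiE Mq; rewrite /FDe /vertical_part FPiE.
have [sRhat [[OD oOD DE] D0] RP] := hRhat.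
(* D is only relatively open: nearness gives membership in [OD], and [vertical_part_tangent] gives
   membership in the vertical bundle. *)
have nD : \forall q \near q0, tangent_bundle (Gr_bundle M k) q ->
    D (q.1, vertical_part M q.1.1 q.2.2).
  have sD : smooth_at (fun q : A => (q.1, FDe q)) q0.
    by apply: smooth_at_pair => //; apply: smooth_at_fst; exact: smooth_at_id.
  have DD0 : OD (q0.1, FDe q0).
    by rewrite (nbhs_singleton FDeE)//; move: DD; rewrite DE => -[].
  have nOD := near_smooth_at sD (open_nbhs_nbhs (conj oOD DD0)).
  apply: filterS2 FDeE nOD => -[[x P] [u De]] /= FDeE ODq TBq.
  have [Mx GP Tu] := tangent_bundle_Gr TBq.
  rewrite DE; split; last by rewrite -FDeE.
  by case: TBq => Gq /= Tq; exact: (vertical_part_tangent hM Gq Tq).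
have [StW PW] := nbhs_singleton FVE TB.
rewrite /= in StW PW; set W := FV q0 in StW PW.
have FDe0 : FDe q0 = vertical_part M x0 De0 := nbhs_singleton FDeE Mx0.
have LB : lift_bundle M (x0, W, FDe q0).
  split; first by split.
  rewrite /= -PW FDe0; case: TB => Gq /= Tq.
  by have [] := vertical_part_tangent hM Gq Tq.
have [FR [sFR FRE]] := (smooth_mapP _ _).1 sRhat _ LB.
(* The joint smoothness of [Rhat] is in (x, V, Delta); P is recovered as V V^T, which [FV] satisfies
   on the tangent bundle. *)
pose FZ (q : A) := FR ((q.1.1, FV q), FDe q).
have sarg : smooth_at (fun q : A => ((q.1.1, FV q), FDe q)) q0.
  by apply: smooth_at_pair => //; exact: smooth_at_pair.
have sFZ : smooth_at FZ q0 by apply: smooth_at_comp sarg _.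
have FZE : \forall q \near q0, tangent_bundle (Gr_bundle M k) q ->
    FZ q = Zmap M Rhat q.1.1 q.1.2 (FV q) q.2.2.
  have {}FRE := near_smooth_at sarg FRE.
  apply: filterS3 FRE FVE FDeE => -[[x P] [u De]] /= FRE FVE FDeE TBq.
  have [StV PV] := FVE TBq; have [Mx GP Tu] := tangent_bundle_Gr TBq.
  rewrite /FZ /= FRE /=.
    by rewrite /Zmap -PV FDeE.
  split; first by split.
  rewrite /= -PV FDeE//; case: TBq => Gq /= Tq.
  by have [] := vertical_part_tangent hM Gq Tq.
have Z0E : FZ q0 = Zmap M Rhat x0 P0 W De0 := nbhs_singleton FZE TB.
have [sVT _ _ _] := hVT.
(* [VT] is extended around a different point for each column of Z, hence one extension per column;
   the finitely many neighbourhoods are intersected below. *)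
have /choice[FC FCE] : forall j : 'I_k, exists FC : 'cV[R]_n * 'cV[R]_n * 'cV[R]_n -> 'cV[R]_n,
    smooth_at FC ((x0, u0), col j (FZ q0)) /\
    \forall q \near ((x0, u0), col j (FZ q0)),
      [/\ M q.1.1, tangent M q.1.1 q.1.2 & tangent M q.1.1 q.2] ->
      FC q = VT q.1.1 q.1.2 q.2.
  move=> j; apply: ((smooth_mapP _ _).1 sVT); split=> //=.
  by rewrite Z0E; exact: (Rhat_tangent Mx0 StW PW).
pose argC j (q : A) := ((q.1.1, q.2.1), col j (FZ q)).
have sargC j : smooth_at (argC j) q0.
  by apply: smooth_at_pair; [exact: smooth_at_pair|exact: smooth_at_col].
pose FY (q : A) : 'M[R]_(n, k) := \matrix_(i, j) FC j (argC j q) i 0.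
have sFY : smooth_at FY q0.
  apply: smooth_at_mx => i j; apply: (@smooth_at_ext _ _ _ (fun q => FC j (argC j q) i 0)).
    by move=> q; rewrite mxE.
  by apply: smooth_at_coord; apply: smooth_at_comp (sargC j) _; exact: (FCE j).1.
exists FV, FY; split=> //.
have FCE' : \forall q \near q0, forall j,
      [/\ M q.1.1, tangent M q.1.1 q.2.1 & tangent M q.1.1 (col j (FZ q))] ->
      FC j (argC j q) = VT q.1.1 q.2.1 (col j (FZ q)).
  have nj j := near_smooth_at (sargC j) (FCE j).2.
  exact: (filter_forall (nbhs_filter q0) nj).
apply: filterS3 (filterI nD FVE) FZE FCE' => -[[x P] [u De]] [/= nD' FVE'] FZE' FCE' TBq.
have [StV PV] := FVE' TBq; have DDq := nD' TBq.
have [Mx GP Tu] := tangent_bundle_Gr TBq.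
split=> //; apply/matrixP => i j; rewrite !mxE FCE' ?FZE'//.
by split=> //; exact: (Rhat_tangent Mx StV PV).
Qed.

(** Full rank of Y is an open condition, so the same extension yields the relative openness of the
    domain and the smoothness of the retraction. *)
Lemma Gr_retraction_extension q0 : Gr_domain M VT Rhat D q0 ->
  exists F, smooth_at F q0 /\ \forall q \near q0, tangent_bundle (Gr_bundle M k) q ->
    Gr_domain M VT Rhat D q /\ F q = Gr_retraction q.1 q.2.
Proof.
case: q0 => -[x0 P0] [u0 De0] q0D; have [TB DD rY] := q0D.
have [FV [FY [sFY FYE]]] := Ymap_extension TB DD.
have [Mx0 GP0 Tu0] := tangent_bundle_Gr TB.
have [_ StV0 PV0 FY0] := nbhs_singleton FYE TB; rewrite /= in StV0 PV0 FY0.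
have rFY0 : \rank (FY (x0, P0, (u0, De0))) = k by rewrite FY0; exact: rY.
have [_ _ sRM _ _] := hRM.
have [FM [sFM FME]] := (smooth_mapP _ _).1 sRM (x0, u0) (conj Mx0 Tu0).
pose A := ('cV[R]_n * 'M[R]_n * ('cV[R]_n * 'M[R]_n))%type.
have sarg : smooth_at (fun q : A => (q.1.1, q.2.1)) (x0, P0, (u0, De0)).
  apply: smooth_at_pair; apply: smooth_at_fst; [apply: smooth_at_fst|apply: smooth_at_snd];
    exact: smooth_at_id.
exists (fun q : A => (FM (q.1.1, q.2.1), range_proj (FY q))); split.
  apply: smooth_at_pair; last exact: smooth_at_range_proj.
  by apply: smooth_at_comp sarg _.
have {}FME := near_smooth_at sarg FME.
have nr := near_full_rank sFY rFY0.
apply: filterS3 nr FME FYE => -[[x P] [u De]] /= rq FME FYE TBq.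
have [DDq StV PV FYq] := FYE TBq; have [Mx GP Tu] := tangent_bundle_Gr TBq.
rewrite FYq in rq *; have qD := Gr_domainI TBq DDq StV PV rq.
split=> //; rewrite (Gr_retractionE qD StV PV) FME//=.
by rewrite Ptilde_range_proj.
Qed.

(** * Values and differentials at the zero section *)

Lemma Ymap0 x P V : Gr_bundle M k (x, P) -> Stiefel k (tangent M x) V -> P = V *m V^T ->
  Y x P V 0 0 = V.
Proof.
move=> Gq StV PV; have [/= Mx _] := Gq.
have [_ _ RP] := hRhat; have [RV0 _] := RP x P V Gq StV PV; have [_ _ _ VT0] := hVT.
have v0 : vertical_part M x 0 = 0 by rewrite /vertical_part mulmx0 mul0mx.
apply/matrixP => i j; rewrite !mxE /Zmap v0 RV0 VT0 ?mxE//.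
by have [_ TV] := StV; exact: TV.
Qed.

Lemma Gr_domain_zero q : Gr_bundle M k q -> Gr_domain M VT Rhat D (q, 0).
Proof.
case: q => x P Gq; have [/= Mx GP] := Gq.
have [V [StV PV]] := Grassmann_frame (PiP Mx) GP.
have [_ [_ D0] _] := hRhat.
have v0 : vertical_part M x 0 = 0 by rewrite /vertical_part mulmx0 mul0mx.
have TB : tangent_bundle (Gr_bundle M k) ((x, P), 0) by split=> //=; exact: tangent0.
apply: (Gr_domainI (V := V)) => //; first by rewrite v0; exact: D0.
by rewrite Ymap0//; apply: rank_stiefel; case: StV.
Qed.

Lemma Gr_retraction0 q : Gr_bundle M k q -> Gr_retraction q 0 = q.
Proof.
move=> Gq; have qD := Gr_domain_zero Gq; have [StV PV] := Gr_frameP Gq.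
case: q Gq qD StV PV => x P Gq qD StV PV; rewrite /Gr_retraction /=.
have [_ _ _ RM0 _] := hRM; have [/= Mx _] := Gq.
have VV := StV.1; have Y0 := Ymap0 Gq StV PV.
rewrite RM0// Ptilde_range_proj; rewrite Y0; last exact: rank_stiefel.
by rewrite range_proj_stiefel// -PV.
Qed.

(** [Gr_lift_family] gives the derivative identity only for Delta in D. Both of its sides are
    homogeneous in Delta, so a small multiple of each tangent vector suffices. *)
Lemma Rhat_derivative x P V : Gr_bundle M k (x, P) ->
  Stiefel k (tangent M x) V -> P = V *m V^T ->
  exists F : 'M[R]_n -> 'M[R]_(n, k), [/\ smooth_at F 0, F 0 = V,
    \forall De \near (0 : 'M[R]_n), tangent_Gr M k x P De -> F De = Rhat x P V De
  & forall De, tangent_Gr M k x P De -> 'D_De F 0 *m V^T + V *m ('D_De F 0)^T = De].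
Proof.
move=> Gq StV PV; have [sR [[OD oOD DE] D0] RP] := hRhat; have [/= Mx GP] := Gq.
have [RV0 RV] := RP x P V Gq StV PV.
have T0 : tangent_Gr M k x P 0 by exact: tangent0.
have LB De : tangent_Gr M k x P De -> lift_bundle M (x, V, De).
  by move=> TDe; split; [split|rewrite /= -PV].
have [FR [sFR FRE]] := (smooth_mapP _ _).1 sR _ (LB 0 T0).
pose arg (De : 'M[R]_n) := (x, V, De).
have sarg : smooth_at arg 0.
  by apply: smooth_at_pair; [exact: smooth_at_cst|exact: smooth_at_id].
pose F De := FR (arg De).
have sF : smooth_at F 0 by apply: smooth_at_comp sarg _.
have FE : \forall De \near (0 : 'M[R]_n), tangent_Gr M k x P De -> F De = Rhat x P V De.
  have {}FRE := near_smooth_at sarg FRE.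
  by apply: filterS FRE => De FRE TDe; rewrite /F FRE; [rewrite /= -PV|exact: LB].
exists F; split=> //; first by rewrite (nbhs_singleton FE).
move=> De TDe; have dF := smooth_at_differentiable sF.
have line t : t *: De = (fun s : R => 0 + s *: De) t by rewrite add0r.
(* D contains the zero section and is relatively open, so it meets the ray through [De] at some
   nonzero t. *)
have [t t0 Dt] : exists2 t : R, t != 0 & D (x, P, t *: De).
  have sl : smooth_at (fun t : R => (x, P, t *: De)) 0.
    apply: smooth_at_pair; first exact: smooth_at_cst.
    by apply: smooth_at_ext (smooth_at_line 0 De 0) => t; rewrite add0r.
  have OD0 : OD (x, P, 0 *: De).
    by rewrite scale0r; move: (D0 x P Gq); rewrite DE => -[].
  have nOD := near_smooth_at sl (open_nbhs_nbhs (conj oOD OD0)).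
  have [e /= e0 eOD] := (nbhs_ballP _ _).1 nOD.
  exists (e / 2); first by rewrite mulf_neq0// ?gt_eqF// invr_gt0.
  rewrite DE; split; first by split=> //=; exact: tangent_scale.
  apply: eOD; rewrite /= /ball /= sub0r normrN gtr0_norm ?divr_gt0//.
  by rewrite ltr_pdivrMr// ltr_pMr// ltr1n.
have [_ _ _] := RV _ Dt.
have TT : tangent (tangent_Gr M k x P) 0 (t *: De).
  exists (fun s => 0 + s *: (t *: De)); apply: curve_through_line.
  by near=> s; rewrite add0r scalerA; exact: tangent_scale.
have := is_mdiff_mdiff (is_mdiff_extension TT dF FE) => -> /=.
have -> : 'D_(t *: De) F 0 = t *: 'D_De F 0 by rewrite !deriveE// linearZ.
rewrite linearZ /= -scalemxAl -scalemxAr -scalerDr => /(congr1 (fun A => t^-1 *: A)).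
by rewrite !scalerA mulVf// !scale1r.
Unshelve. all: by end_near. Qed.

Hypothesis hII : forall x u v, M x -> tangent M x u -> tangent M x v ->
  mdiff (tangent M x) (fun iota => VT x iota v) 0 u = second_ff M x u v
  /\ normal (tangent M x) (second_ff M x u v).

(** The direction splits in two: varying v at delta = 0 gives w, since the transport is then the
    identity, and varying delta at fixed v gives the second fundamental form by [hII].
    Differentiability of the extension lets the two add. *)
Lemma VT_derivative x v : M x -> tangent M x v ->
  exists F : 'cV[R]_n * 'cV[R]_n * 'cV[R]_n -> 'cV[R]_n,
  [/\ smooth_at F ((x, 0), v),
    \forall q \near ((x, 0 : 'cV[R]_n), v), M q.1.1 -> tangent M q.1.1 q.1.2 ->
      tangent M q.1.1 q.2 -> F q = VT q.1.1 q.1.2 q.2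
  & forall u w, tangent M x u -> tangent (tangent M x) v w ->
      'D_(((0, u), w) : 'cV[R]_n * 'cV[R]_n * 'cV[R]_n) F ((x, 0), v) = w + second_ff M x u v].
Proof.
move=> Mx Tv; have [sVT _ _ VT0] := hVT.
have T0 : tangent M x 0 by exact: tangent0.
have [F [sF FE]] := (smooth_mapP _ _).1 sVT ((x, 0), v) (And3 Mx T0 Tv).
exists F; split=> //; first by apply: filterS FE => q FE *; exact: FE.
move=> u w Tu [c cc]; have dF := smooth_at_differentiable sF.
have -> : ((0, u), w) = ((0, u), 0) + ((0, 0), w) :> 'cV[R]_n * 'cV[R]_n * 'cV[R]_n.
  by congr (_, _, _); rewrite /= ?addr0 ?add0r.
rewrite deriveE// linearD /= -!deriveE// addrC; congr (_ + _).
  move/curve_throughP: (cc) => [sc Tc c0 dc].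
  have dcF : differentiable F ((x, 0), c 0) by rewrite c0.
  have := is_derive_curve (is_derive_pair (is_derive_cst (x, 0 : 'cV[R]_n) 0 (1 : R)) dc) dcF.
  rewrite c0 => dFc; apply: (is_derive_unique dFc).
  apply: near_eq_is_derive dc.
  have sc' : smooth_at (fun t => ((x, 0 : 'cV[R]_n), c t)) 0.
    by apply: smooth_at_pair => //; exact: smooth_at_cst.
  have FE' : \forall t \near (0 : R), [/\ M x, tangent M x 0 & tangent M x (c t)] ->
      F ((x, 0), c t) = VT x 0 (c t).
    have FE0 : \forall q \near ((x, 0 : 'cV[R]_n), c 0), [/\ M q.1.1, tangent M q.1.1 q.1.2
        & tangent M q.1.1 q.2] -> F q = VT q.1.1 q.1.2 q.2 by rewrite c0.
    exact: (near_smooth_at sc' FE0).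
  by apply: filterS2 Tc FE' => t Tct FE'; rewrite /cst FE'// VT0.
(* What remains is the direction u, for which G extends the map differentiated in [hII]. *)
have [<- _] := hII Mx Tu Tv.
pose G (i : 'cV[R]_n) := F ((x, i), v).
have sarg : smooth_at (fun i : 'cV[R]_n => ((x, i), v)) 0.
  apply: smooth_at_pair; last exact: smooth_at_cst.
  by apply: smooth_at_pair; [exact: smooth_at_cst|exact: smooth_at_id].
have sG : smooth_at G 0 by apply: smooth_at_comp sarg _.
have GE : \forall i \near (0 : 'cV[R]_n), tangent M x i -> G i = VT x i v.
  by apply: filterS (near_smooth_at sarg FE) => i FE' Ti; rewrite /G FE'.
have TT : tangent (tangent M x) 0 u.
  exists (fun s => 0 + s *: u); apply: curve_through_line.
  by near=> s; rewrite add0r; exact: tangent_scale.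
rewrite (is_mdiff_mdiff (is_mdiff_extension TT (smooth_at_differentiable sG) GE)).
have dl : is_derive (0 : R) (1 : R) (fun s : R => 0 + s *: u) u by exact: is_derive_line.
have l0 : 0 + 0 *: u = 0 :> 'cV[R]_n by rewrite scale0r addr0.
have dG' : differentiable G (0 + (0 : R) *: u) by rewrite l0; exact: smooth_at_differentiable.
have := is_derive_curve dl dG'; rewrite l0 => dGl; apply/esym; apply: (is_derive_unique dGl).
have dF' : differentiable F ((x, 0 + (0 : R) *: u), v) by rewrite l0.
have := is_derive_curve (is_derive_pair (is_derive_pair (is_derive_cst x 0 (1 : R)) dl)
  (is_derive_cst v 0 (1 : R))) dF'.
by rewrite l0.
Unshelve. all: by end_near. Qed.

(** The base point (x, P) does not move along c, so the constant frame V serves for all t. *)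
Lemma is_derive_Ptilde x P V c u De : Gr_bundle M k (x, P) ->
  Stiefel k (tangent M x) V -> P = V *m V^T ->
  tangent (Gr_bundle M k) (x, P) (u, De) ->
  curve_through [set w | Gr_domain M VT Rhat D ((x, P), w)] 0 (u, De) c ->
  is_derive (0 : R) (1 : R) (fun t => Ptilde M VT Rhat x P V (c t).1 (c t).2) De.
Proof.
move=> Gq StV PV TuDe /curve_throughP[sc Dc c0 dc]; have [/= Mx GP] := Gq.
have {}Dc : \forall t \near (0 : R), [/\ tangent M x (c t).1,
    tangent_Gr M k x P (vertical_part M x (c t).2), D (x, P, vertical_part M x (c t).2)
    & \rank (Y x P V (c t).1 (c t).2) = k].
  apply: filterS Dc => t; case: (c t) => u' De' [TB DD rY].
  have [_ _ Tu'] := tangent_bundle_Gr TB; have [_ Tq] := TB.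
  by split=> //; [case: (vertical_part_tangent hM Gq Tq)|exact: rY].
have [VV PiV] := (StiefelP (PiP Mx) _).1 StV.
have [F [sF F0 FE FD]] := Rhat_derivative Gq StV PV.
have [Tu Det DeP Pi't Pi'P] := tangent_Gr_bundleP hM Mx TuDe.
set Pi' := mdiff _ _ _ _ in Pi't Pi'P; set Pi := tangent_proj M x in PiV Pi'P.
have vert : vertical_bundle M k (x, P, vertical_part M x De).
  exact: (vertical_part_tangent hM Gq TuDe).
have sdel : smooth_at (fun t => (c t).1) 0 by exact: smooth_at_fst.
have sDel : smooth_at (fun t => (c t).2) 0 by exact: smooth_at_snd.
have ddel : is_derive (0 : R) (1 : R) (fun t => (c t).1) u := is_derive_fst dc.
have dDel : is_derive (0 : R) (1 : R) (fun t => (c t).2) De := is_derive_snd dc.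
pose X t := vertical_part M x (c t).2.
have sX : smooth_at X 0.
  apply: smooth_at_mulmx; last exact: smooth_at_cst.
  by apply: smooth_at_mulmx => //; exact: smooth_at_cst.
have dX : is_derive (0 : R) (1 : R) X (vertical_part M x De).
  have dPi := is_derive_cst Pi (0 : R) (1 : R).
  have := is_derive_mulmx (is_derive_mulmx dPi dDel) dPi.
  by rewrite mul0mx add0r mulmx0 addr0.
have X0 : X 0 = 0 by rewrite /X c0 /vertical_part mulmx0 mul0mx.
pose Z t := F (X t).
have sZ : smooth_at Z 0 by apply: smooth_at_comp sX _; rewrite X0.
have Z0 : Z 0 = V by rewrite /Z X0.
pose dZ := 'D_(vertical_part M x De) F 0.
have dZt : is_derive (0 : R) (1 : R) Z dZ.
  have dF : differentiable F (X 0) by rewrite X0; exact: smooth_at_differentiable.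
  by have := is_derive_curve dX dF; rewrite X0.
have dZE : dZ *m V^T + V *m dZ^T = vertical_part M x De by apply: FD; case: vert.
have ZE : \forall t \near (0 : R), Z t = Zmap M Rhat x P V (c t).2.
  have FE0 : \forall A \near X 0, tangent_Gr M k x P A -> F A = Rhat x P V A by rewrite X0.
  by apply: filterS2 Dc (near_smooth_at sX FE0) => t [_ TX _ _]; exact.
have TZ : \forall t \near (0 : R), forall j, tangent M x (col j (Z t)).
  by apply: filterS2 Dc ZE => t [_ _ DD _] -> j; exact: (Rhat_tangent Mx StV PV).
have TV j : tangent M x (col j V) by have [_ TV] := StV; exact: TV.
have /choice[FC FCE] := fun j => VT_derivative Mx (TV j).
pose arg j t := ((x, (c t).1), col j (Z t)).
have sarg j : smooth_at (arg j) 0.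
  apply: smooth_at_pair; last exact: smooth_at_col.
  by apply: smooth_at_pair => //; exact: smooth_at_cst.
have arg0 j : arg j 0 = ((x, 0), col j V) by rewrite /arg c0 Z0.
pose Y1 t : 'M[R]_(n, k) := \matrix_(i, j) FC j (arg j t) i 0.
have sFC j : smooth_at (fun t => FC j (arg j t)) 0.
  by apply: smooth_at_comp (sarg j) _; rewrite arg0; case: (FCE j).
have sY1 : smooth_at Y1 0.
  apply: smooth_at_mx => i j; apply: smooth_at_ext (smooth_at_coord i 0 (sFC j)) => t.
  by rewrite mxE.
have YE : \forall t \near (0 : R), Y1 t = Y x P V (c t).1 (c t).2.
  have FCn : \forall t \near (0 : R), forall j, M x -> tangent M x (c t).1 ->
      tangent M x (col j (Z t)) -> FC j (arg j t) = VT x (c t).1 (col j (Z t)).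
    have nj j : \forall t \near (0 : R), M x -> tangent M x (c t).1 ->
        tangent M x (col j (Z t)) -> FC j (arg j t) = VT x (c t).1 (col j (Z t)).
      have [_ FCj _] := FCE j; rewrite -arg0 in FCj.
      exact: (near_smooth_at (sarg j) FCj).
    exact: (filter_forall (nbhs_filter (0 : R)) nj).
  apply: filterS3 (filterI Dc ZE) TZ FCn => t [[Tut _ _ _] ZtE] TZt FCt.
  by apply/matrixP => i j; rewrite !mxE FCt// ZtE.
pose dY := dZ + Pi' *m V.
have dY1 : is_derive (0 : R) (1 : R) Y1 dY.
  have dcol j : is_derive (0 : R) (1 : R) (fun t => col j (Z t)) (col j dZ).
    apply/is_derive_mxP => i l; rewrite mxE; have /is_derive_mxP := dZt => /(_ i j).
    by congr is_derive; apply/funext => t; rewrite mxE.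
  have dFC j : is_derive (0 : R) (1 : R) (fun t => FC j (arg j t)) (col j dZ + Pi' *m col j V).
    have [sFCj _ FCD] := FCE j.
    have dFj : differentiable (FC j) (arg j 0).
      by rewrite arg0; exact: smooth_at_differentiable.
    have := is_derive_curve (is_derive_pair (is_derive_pair (is_derive_cst x 0 (1 : R)) ddel)
      (dcol j)) dFj.
    rewrite -/(arg j 0) arg0 FCD//; exists (fun t => col j (Z t)); apply/curve_throughP; split=> //.
    - exact: smooth_at_col.
    - by apply: filterS TZ => t; exact.
    - by rewrite Z0.
  apply/is_derive_mxP => i j; have /is_derive_mxP := dFC j => /(_ i 0).
  have -> : (col j dZ + Pi' *m col j V) i 0 = dY i j by rewrite -col_mulmx !mxE.
  by congr is_derive; apply/funext => t; rewrite mxE.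
have Y10 : Y1 0 = V by rewrite (nbhs_singleton YE) c0 Ymap0.
(* Entry (i, j) pairs the tangent column i of V with the normal vector that the second fundamental
   form assigns to column j. *)
have VPi' : V^T *m (Pi' *m V) = 0.
  apply/matrixP => i j; have [_ N] := hII Mx Tu (TV j).
  have := N _ (TV i); rewrite /second_ff -/Pi' => /matrixP/(_ 0 0).
  rewrite -col_mulmx !mxE => NE; rewrite -[RHS]NE; apply: eq_bigr => l _.
  by rewrite !mxE.
have PDP : V^T *m De *m V = 0 by apply: stiefel_diag_block => //; rewrite -PV.
have [Pit PiPi _] := PiP Mx; rewrite -/Pi in Pit PiPi.
have VPi : V^T *m Pi = V^T by rewrite -[LHS]trmxK trmx_mul Pit trmxK PiV.
(* Compressing [dZE] by V leaves V^T De V on the right, which is zero by [PDP]. *)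
have skewZ : V^T *m dZ + dZ^T *m V = 0.
  have := congr1 (fun A => V^T *m A *m V) dZE.
  rewrite mulmxDr mulmxDl !mulmxA VV mul1mx -[V^T *m dZ *m V^T *m V]mulmxA VV mulmx1 => ->.
  by rewrite -/Pi VPi -(mulmxA _ Pi) PiV PDP.
have skew : V^T *m dY + dY^T *m V = 0.
  rewrite /dY mulmxDr VPi' addr0 linearD mulmxDl /= trmx_mul Pi't.
  by rewrite -[V^T *m Pi' *m V]mulmxA VPi' addr0.
have := is_derive_range_proj sY1 Y10 VV dY1 skew.
have -> : dY *m V^T + V *m dY^T = De.
  (* The transpose of [Pi'P]; with P Pi = P, the two identities determine Pi De Pi. *)
  have PPi' : P *m Pi' + De *m Pi = De.
    have [Pt _ _ _] := (GrassmannP k (PiP Mx) _).1 GP.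
    by rewrite -{2}Det -[in RHS]Pi'P linearD /= !trmx_mul Pi't Pit Pt Det.
  rewrite /dY linearD /= trmx_mul Pi't mulmxDl mulmxDr addrACA dZE.
  rewrite !mulmxA -PV -mulmxA -PV /vertical_part -/Pi.
  have -> : Pi *m De *m Pi = De - Pi' *m P - P *m Pi'.
    have PiDe : Pi *m De = De - Pi' *m P by rewrite -{2}Pi'P addrC addKr.
    have DePi : De *m Pi = De - P *m Pi' by rewrite -{2}PPi' addrC addKr.
    have PPi : P *m Pi = P by rewrite PV -mulmxA VPi.
    by rewrite PiDe mulmxBl DePi -mulmxA PPi addrAC.
  by rewrite -[De - _ - _]addrA -opprD subrK.
apply: near_eq_is_derive; apply: filterS2 Dc YE => t [_ _ _ rY] ->.
by rewrite Ptilde_range_proj.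
Qed.

Lemma Gr_retraction_is_mdiff q w : Gr_bundle M k q -> tangent (Gr_bundle M k) q w ->
  is_mdiff [set w' | Gr_domain M VT Rhat D (q, w')] (Gr_retraction q) 0 w w.
Proof.
case: q w => x P [u De] Gq Tw; have [/= Mx _] := Gq.
split.
  (* The direction must be tangent to the fibre of the domain: the ray through it stays in the
     domain for small t, by openness at the zero section. *)
  exists (fun t => 0 + t *: (u, De)); apply: curve_through_line.
  have [F [_ FE]] := Gr_retraction_extension (Gr_domain_zero Gq).
  have sl : smooth_at (fun t : R => ((x, P), 0 + t *: (u, De))) 0.
    by apply: smooth_at_pair; [exact: smooth_at_cst|exact: smooth_at_line].
  have FE0 : \forall q \near ((x, P), 0 + (0 : R) *: (u, De)), tangent_bundle (Gr_bundle M k) q ->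
      Gr_domain M VT Rhat D q /\ F q = Gr_retraction q.1 q.2 by rewrite scale0r addr0.
  apply: filterS (near_smooth_at sl FE0) => t Ft; apply: (Ft _).1; split=> //=.
  by rewrite add0r; exact: tangent_scale.
move=> c cc; have [StV PV] := Gr_frameP Gq; rewrite /= in StV PV.
have dP := is_derive_Ptilde Gq StV PV Tw cc.
move/curve_throughP: (cc) => [sc Dc c0 dc].
have [Tu _ _ _ _] := tangent_Gr_bundleP hM Mx Tw.
have [_ _ _ _ RMd] := hRM; have [_ dRM] := RMd x u Mx Tu.
have cu : curve_through [set w | tangent_bundle M (x, w)] 0 u (fun t => (c t).1).
  apply/curve_throughP; split.
  - exact: smooth_at_fst.
  - apply: filterS Dc => t; case: (c t) => u' De' [TB _ _].
    by have [? _ ?] := tangent_bundle_Gr TB; split.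
  - by rewrite c0.
  - exact: is_derive_fst dc.
exact: is_derive_pair (dRM _ cu) dP.
Qed.

Lemma Gr_domain_tangent : Gr_domain M VT Rhat D `<=` tangent_bundle (Gr_bundle M k).
Proof. by move=> [[x P] [u De]] []. Qed.

Lemma Gr_retraction_on :
  retraction_on (Gr_bundle M k) (Gr_domain M VT Rhat D) Gr_retraction.
Proof.
split.
- split; last exact: Gr_domain_zero.
  apply: rel_open_near => [|q qD]; first exact: Gr_domain_tangent.
  have [F [_ FE]] := Gr_retraction_extension qD.
  by apply: filterS FE => q' FE /FE[].
- by move=> q w; exact: Gr_retraction_bundle.
- apply/smooth_mapP => q qD; have [F [sF FE]] := Gr_retraction_extension qD.
  by exists F; split=> //; apply: filterS FE => q' FE /Gr_domain_tangent/FE[].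
- exact: Gr_retraction0.
- exact: Gr_retraction_is_mdiff.
Qed.

End GrassmannRetraction.

Unset Implicit Arguments.

Theorem lemma5 (R : realType) (n d k : nat) (M : set 'cV[R]_n)
  (hM : embedded_submanifold d M) (hk : (1 <= k < d)%N)
  (RM : 'cV[R]_n -> 'cV[R]_n -> 'cV[R]_n)
  (hRM : retraction M RM)
  (Rhat : 'cV[R]_n -> 'M[R]_n -> 'M[R]_(n, k) -> 'M[R]_n -> 'M[R]_(n, k))
  (D : set ('cV[R]_n * 'M[R]_n * 'M[R]_n))
  (hRhat : Gr_lift_family M Rhat D)
  (VT : 'cV[R]_n -> 'cV[R]_n -> 'cV[R]_n -> 'cV[R]_n)
  (hVT : vector_transport M RM VT)
  (hII : forall x delta v : 'cV[R]_n, M x -> tangent M x delta -> tangent M x v ->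
     mdiff (tangent M x) (fun iota => VT x iota v) 0 delta
       = second_ff M x delta v
     /\ normal (tangent M x) (second_ff M x delta v))
  (hinj : forall x : 'cV[R]_n, M x -> exists2 N1 : set 'cV[R]_n, nbhs (0 : 'cV[R]_n) N1 &
     forall delta : 'cV[R]_n, N1 delta -> tangent M x delta ->
       set_inj (tangent M x) (VT x delta)) :
  exists (RGr : 'cV[R]_n * 'M[R]_n -> 'cV[R]_n * 'M[R]_n ->
                'cV[R]_n * 'M[R]_n)
         (RSt : 'cV[R]_n * 'M[R]_(n, k) -> 'cV[R]_n * 'M[R]_(n, k) ->
                'cV[R]_n * 'M[R]_(n, k)),
    [/\ forall x P delta Delta V,
          Gr_domain M VT Rhat D ((x, P), (delta, Delta)) ->
          Stiefel k (tangent M x) V -> P = V *m V^T ->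
          RGr (x, P) (delta, Delta)
            = (RM x delta, Ptilde M VT Rhat x P V delta Delta),
        retraction_on (Gr_bundle M k) (Gr_domain M VT Rhat D) RGr
      & forall x V delta Delta,
          St_bundle M k (x, V) ->
          Gr_domain M VT Rhat D ((x, V *m V^T), (delta, Delta)) ->
          [/\ RSt (x, V) (delta, Delta *m V)
                = (RM x delta, Vtilde M VT Rhat x (V *m V^T) V delta Delta),
              St_bundle M k (RSt (x, V) (delta, Delta *m V))
            & St_to_Gr (RSt (x, V) (delta, Delta *m V))
                = RGr (St_to_Gr (x, V)) (delta, Delta)]].
Proof.
(* The representative receives only the lift W = Delta V. Since Delta is symmetric and Delta P + P
   Delta = Delta, it is recovered as W V^T + V W^T. *)
pose St_retraction (q w : 'cV[R]_n * 'M[R]_(n, k)) :=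
  (RM q.1 w.1, Vtilde M VT Rhat q.1 (q.2 *m q.2^T) q.2 w.1 (w.2 *m q.2^T + q.2 *m w.2^T)).
exists (Gr_retraction (M := M) RM Rhat VT), St_retraction; split.
- by move=> x P u De V; exact: (Gr_retractionE hM hRhat hVT).
- exact: (Gr_retraction_on hM hRM hRhat hVT hII).
move=> x V u De [/= Mx StV] qD.
have [[Gq /= Tw] _ _] := qD.
have [_ Det DeP _ _] := tangent_Gr_bundleP hM Mx Tw.
have -> : St_retraction (x, V) (u, De *m V)
    = (RM x u, Vtilde M VT Rhat x (V *m V^T) V u De).
  by rewrite /St_retraction /= trmx_mul Det mulmxA -(mulmxA De) DeP.
split=> //; first exact: (Vtilde_Stiefel hM hRM hRhat hVT qD StV erefl).
by rewrite /St_to_Gr /= (Gr_retractionE hM hRhat hVT qD StV erefl).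
Qed.
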